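(* Suppose that the sequence of stochastic block models and seed numbers satisfies assumptions $(C)$ and that condition $(\mathbf{Sup})$ holds, that is, $\mathcal{E}_1\cap\mathcal{E}_2=\emptyset$ (all notation as in the context). Then for every $\varepsilon>0$ there exists a constant $c(\varepsilon)\in(0,\infty)$ such that, as $n\to\infty$, $$P\left(\left|\frac{|\mathcal{G}|}{n}-1\right|>\varepsilon\right)=O\left(\mathrm{e}^{-c(\varepsilon)g_1}\right),$$ where $\mathcal{G}$ is the final set of active nodes.
   Context: Model. For each $n=n_1+n_2$ (with $n_1,n_2$ depending on $n$), the stochastic block model $G=G(n_1,n_2,p_1,p_2,q)$, with $p_1,p_2,q\in[0,1)$ depending on $n$, is the random graph formed by the union of two disjoint Erdős–Rényi random graphs $G_i=G(n_i,p_i)$, $i=1,2$ (the communities; $n_i$ nodes, each pair of nodes independently joined with probability $p_i$), where in addition each pair of nodes in different communities is joined by an edge independently with probability $q$. Bootstrap percolation. Fix an integer $r\ge 2$. Initially, for $i=1,2$, a number $a_i\le n_i$ (depending on $n$) of nodes, called seeds, are chosen uniformly at random among the nodes of $G_i$; seeds are active and all other nodes are inactive. An inactive node becomes active as soon as at least $r$ of its neighbors are active, and then remains active forever. The process stops when no more nodes can be activated. $\mathcal{G}$ denotes the final set of active nodes (of the whole graph, seeds included), and $|\cdot|$ denotes cardinality. Asymptotics. All limits are as $n\to\infty$; $f_1\ll f_2$ means $f_1/f_2\to0$, $f_1\sim f_2$ means $f_1/f_2\to1$, and $f_1=O(f_2)$ means $\limsup|f_1/f_2|<\infty$. Define $$g_i:=\left(1-\frac1r\right)\left(\frac{(r-1)!}{n_ip_i^r}\right)^{\frac1{r-1}},\quad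 i=1,2.$$ Assumptions $(C)$: - $n_1\sim\nu n_2$ for some $\nu\in(0,\infty)$; - $q\sim\gamma p_1$ for some $\gamma\in(0,\infty)$ and $p_1\sim\mu p_2$ for some $\mu\in(0,\infty)$; - $1/n_i\ll p_i\ll 1/n_i^{1/r}$ for $i=1,2$; - $a_i/g_i\to\alpha_i\ge0$ for $i=1,2$; - $\alpha_1\ge\alpha_2$ and $\alpha_1>0$. Notation. $\chi_{12}:=\gamma(\nu\mu^r)^{1/(r-1)}$, $\chi_{21}:=\gamma(\nu\mu)^{-1/(r-1)}$. For $\mathbf{x}=(x_1,x_2)\in[0,\infty)^2$ and $\{i,j\}=\{1,2\}$, $$\rho_i(\mathbf{x}):=\alpha_i-x_i+r^{-1}(1-r^{-1})^{r-1}(x_i+\chi_{ij}x_j)^r.$$ $$\mathcal{D}:=\left\{\mathbf{x}\in[0,r/(r-1)]^2:\ x_1+\chi_{12}x_2\le\tfrac r{r-1},\ x_2+\chi_{21}x_1\le\tfrac r{r-1}\right\},$$ and $\mathcal{E}_i:=\{\mathbf{x}\in\mathcal{D}:\rho_i(\mathbf{x})\le0\}$ for $i=1,2$. *)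

(* Defs.v *)
From HB Require Import structures.
From mathcomp Require Import all_boot all_order all_algebra.
From mathcomp Require Import all_classical all_reals all_analysis.

Set Implicit Arguments.
Unset Strict Implicit.
Unset Printing Implicit Defensive.

Import Order.TTheory GRing.Theory Num.Theory.
Import numFieldNormedType.Exports.
Local Open Scope classical_set_scope.
Local Open Scope ring_scope.

(* Finite graphs: a graph on V is its set of edges, an edge being a           *)
(* two-element set of nodes.                                                  *)

Definition pairs (V : finType) : {set {set V}} :=
  [set e : {set V} | #|e| == 2%N].

Definition adj (V : finType) (g : {set {set V}}) (u v : V) : bool :=
  (u != v) && ([set u; v]%SET \in g).

Definition bp_step (V : finType) (r : nat) (g : {set {set V}}) (A : {set V}) :
    {set V} :=
  (A :|: [set v | (r <= #|[set u in A | adj g u v]|)%N])%SET.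

(* Every round before the process stops activates at least one node, so that  *)
(* #|V| rounds reach the end of it: see [bp_final_stable].                    *)
Definition bp_final (V : finType) (r : nat) (g : {set {set V}})
    (seeds : {set V}) : {set V} :=
  iter #|V| (bp_step r g) seeds.

Lemma bp_final_stable (V : finType) (r : nat) (g : {set {set V}})
    (seeds : {set V}) :
  bp_step r g (bp_final r g seeds) = bp_final r g seeds.
Proof.
rewrite /bp_final; set F := bp_step r g.
have sub (A : {set V}) : A \subset F A by exact: finset.subsetUl.
have [k lek Ek] : exists2 k, (k <= #|V|)%N & F (iter k F seeds) = iter k F seeds.
  apply: contrapT => noFix.
  suff lt m : (m <= #|V|.+1)%N -> (m <= #|iter m F seeds|)%N.
    by have := lt _ (leqnn _); rewrite leqNgt ltnS max_card.
  elim: m => [//|m IH] mV; apply: leq_ltn_trans (IH (ltnW mV)) _.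
  apply: proper_card; rewrite finset.properEneq sub andbT.
  by apply/eqP => E; apply: noFix; exists m.
have fixk j : iter (j + k) F seeds = iter k F seeds.
  by elim: j => [//|j IH]; rewrite addSn iterS IH.
by rewrite -(subnK lek) fixk.
Qed.

Definition sbm_node (n1 n2 : nat) : finType := ('I_n1 + 'I_n2)%type.

Definition community1 (n1 n2 : nat) : {set sbm_node n1 n2} :=
  [set (inl i : sbm_node n1 n2) | i : 'I_n1]%SET.

Definition community2 (n1 n2 : nat) : {set sbm_node n1 n2} :=
  [set (inr i : sbm_node n1 n2) | i : 'I_n2]%SET.

Definition edge_prob (R : realType) (n1 n2 : nat) (p1 p2 q : R)
    (e : {set sbm_node n1 n2}) : R :=
  if e \subset community1 n1 n2 then p1
  else if e \subset community2 n1 n2 then p2 else q.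

Definition sbm_pmf (R : realType) (n1 n2 : nat) (p1 p2 q : R)
    (g : {set {set sbm_node n1 n2}}) : R :=
  if g \subset pairs (sbm_node n1 n2) then
    \prod_(e in pairs (sbm_node n1 n2))
      (if e \in g then edge_prob p1 p2 q e else 1 - edge_prob p1 p2 q e)
  else 0.

Definition seed_pmf (R : realType) (m a : nat) (A : {set 'I_m}) : R :=
  if #|A| == a then ('C(m, a)%:R)^-1 else 0.

(* An outcome consists of the graph and of the seeds of each community; these *)
(* three are independent.                                                     *)
Definition outcome (n1 n2 : nat) : finType :=
  ({set {set sbm_node n1 n2}} * {set 'I_n1} * {set 'I_n2})%type.

Definition outcome_pmf (R : realType) (n1 n2 : nat) (p1 p2 q : R)
    (a1 a2 : nat) (w : outcome n1 n2) : R :=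
  sbm_pmf p1 p2 q w.1.1 * seed_pmf R a1 w.1.2 * seed_pmf R a2 w.2.

Definition Pr (R : realType) (n1 n2 : nat) (p1 p2 q : R) (a1 a2 : nat)
    (E : pred (outcome n1 n2)) : R :=
  \sum_(w | E w) outcome_pmf p1 p2 q a1 a2 w.

Definition seeds (n1 n2 : nat) (w : outcome n1 n2) : {set sbm_node n1 n2} :=
  ([set inl i | i in w.1.2] :|: [set inr i | i in w.2])%SET.

Definition final_active (r n1 n2 : nat) (w : outcome n1 n2) :
    {set sbm_node n1 n2} :=
  bp_final r w.1.1 (seeds w).

Lemma sum_sbm_pmf (R : realType) (n1 n2 : nat) (p1 p2 q : R) :
  \sum_(g : {set {set sbm_node n1 n2}}) sbm_pmf p1 p2 q g = 1.
Proof.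
pose w (e : {set sbm_node n1 n2}) := edge_prob p1 p2 q e.
pose D := pairs (sbm_node n1 n2).
pose F e := if e \in D then w e else 0.
pose G e := if e \in D then 1 - w e else 1.
transitivity (\prod_e (F e + G e)).
  rewrite bigA_distr /=; apply: eq_bigr => g _; rewrite /sbm_pmf -/D.
  case: ifPn => [gD|/fintype.subsetPn[e eg eD]].
    rewrite big_mkcond /=; apply: eq_bigr => e _; rewrite /F /G.
    have [//|eD] := boolP (e \in D).
    by rewrite (contraNF (fintype.subsetP gD e) eD).
  by rewrite (bigD1 e) //= eg /F (negbTE eD) mul0r.
rewrite big1 // => e _; rewrite /F /G.
by case: ifP => _; rewrite ?add0r // addrC subrK.
Qed.

Lemma sum_seed_pmf (R : realType) (m a : nat) (am : (a <= m)%N) :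
  \sum_(A : {set 'I_m}) seed_pmf R a A = 1.
Proof.
rewrite /seed_pmf -big_mkcond /= sumr_const -cardsE card_draws card_ord.
by rewrite -[LHS]mulr_natr mulVf // pnatr_eq0 -lt0n bin_gt0.
Qed.

Lemma Pr_total (R : realType) (n1 n2 : nat) (p1 p2 q : R) (a1 a2 : nat) :
  (a1 <= n1)%N -> (a2 <= n2)%N ->
  @Pr R n1 n2 p1 p2 q a1 a2 predT = 1.
Proof.
move=> h1 h2; rewrite /Pr /outcome_pmf /=.
rewrite -(pair_bigA _ (fun x y => sbm_pmf p1 p2 q x.1 * seed_pmf R a1 x.2
  * seed_pmf R a2 y)) /=.
under eq_bigr do rewrite -mulr_sumr sum_seed_pmf // mulr1.
rewrite -(pair_bigA _ (fun x y => sbm_pmf p1 p2 q x * seed_pmf R a1 y)) /=.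
under eq_bigr do rewrite -mulr_sumr sum_seed_pmf // mulr1.
exact: sum_sbm_pmf.
Qed.

(* Since x / 0 = 0, a quotient is given  *)
(* a meaning only when its denominator is eventually nonzero.                 *)

Definition much_less (R : realType) (f1 f2 : nat -> R) : Prop :=
  (\forall n \near \oo, f2 n != 0) /\
  f1 n / f2 n @[n --> \oo] --> (0 : R).

Definition asymp_equiv (R : realType) (f1 f2 : nat -> R) : Prop :=
  (\forall n \near \oo, f2 n != 0) /\
  f1 n / f2 n @[n --> \oo] --> (1 : R).

Definition is_bigO (R : realType) (f1 f2 : nat -> R) : Prop :=
  (\forall n \near \oo, f2 n != 0) /\
  (limn_esup (fun n => (`|f1 n / f2 n|)%:E) < +oo)%E.

Definition gcrit (R : realType) (r n : nat) (p : R) : R :=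
  (1 - r%:R^-1) * ((r.-1)`!%:R / (n%:R * p ^+ r)) `^ (r%:R - 1)^-1.

Definition chi12 (R : realType) (r : nat) (nu mu gamma : R) : R :=
  gamma * (nu * mu ^+ r) `^ (r%:R - 1)^-1.

Definition chi21 (R : realType) (r : nat) (nu mu gamma : R) : R :=
  gamma * (nu * mu) `^ (- (r%:R - 1)^-1).

(* rho_i at the point whose i-th coordinate is xi and other coordinate is xj, *)
(* with chi standing for chi_ij.                                              *)
Definition rho (R : realType) (r : nat) (alpha chi xi xj : R) : R :=
  alpha - xi + r%:R^-1 * (1 - r%:R^-1) ^+ r.-1 * (xi + chi * xj) ^+ r.

Definition calD (R : realType) (r : nat) (nu mu gamma : R) : set (R * R) :=
  [set x | [/\ 0 <= x.1 <= r%:R / (r%:R - 1),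
               0 <= x.2 <= r%:R / (r%:R - 1),
               x.1 + chi12 r nu mu gamma * x.2 <= r%:R / (r%:R - 1) &
               x.2 + chi21 r nu mu gamma * x.1 <= r%:R / (r%:R - 1)]].

Definition calE1 (R : realType) (r : nat) (nu mu gamma alpha1 : R) :
    set (R * R) :=
  [set x | calD r nu mu gamma x /\
           rho r alpha1 (chi12 r nu mu gamma) x.1 x.2 <= 0].

Definition calE2 (R : realType) (r : nat) (nu mu gamma alpha2 : R) :
    set (R * R) :=
  [set x | calD r nu mu gamma x /\
           rho r alpha2 (chi21 r nu mu gamma) x.2 x.1 <= 0].

(* Main.v *)
Require Import Defs.
From HB Require Import structures.
From mathcomp Require Import all_boot all_order all_algebra.
From mathcomp Require Import all_classical all_reals all_analysis.
From mathcomp Require Import ring lra.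

Set Implicit Arguments.
Unset Strict Implicit.
Unset Printing Implicit Defensive.

Import Order.TTheory GRing.Theory Num.Theory.
Import numFieldNormedType.Exports.
Local Open Scope classical_set_scope.
Local Open Scope ring_scope.

(* The final active set [A] is the least set that contains the seeds and every *)
(* node with [r] neighbours in it. Revealing the graph one active node at a     *)
(* time shows that P(final set = A) is at most the product, over the nodes [v], *)
(* of the probability that [v] has at least (for [v] in [A] not a seed) or      *)
(* fewer than (for [v] outside [A]) [r] neighbours in [A]. Summed over the [A]  *)
(* with [t1] and [t2] nodes in the communities, this is the probability that    *)
(* two independent binomials of means about [n_i pi_i(t1, t2)] equal           *)
(* [t_i - a_i]. In units of [g_i] the excess of the mean over [t_i - a_i] is    *)
(* [rho_i], and under (Sup) one of the [rho_i] is bounded below on every        *)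
(* compact set of the quadrant, so for [t1 + t2 <= K g_1] a Chernoff bound      *)
(* gives exp(- c g_1). For larger [T = t1 + t2] up to a small multiple of [n]   *)
(* the mean exceeds [8 T] and the bound is exp(- T); beyond that, almost every  *)
(* node has [r] active neighbours, which leaves exp(- n) as long as [eps n]     *)
(* nodes are inactive. The sum over all [t1] and [t2] is geometric.             *)

(** The graph and the final set depend on each other, and [Ex_tfinal_le] removes this dependence:
    the probability that percolation stops at a given set [A] is at most a product over the nodes,
    as if all neighbourhoods in [A] were independent. After summation over the sets of a given type
    [(t1, t2)], in [type_sum_le] and [Pr_final_le], what remains is the tilting bound [stop_bound]
    for two independent binomials, with tilts [z1] and [z2] that may be chosen anew for each type.

    The rest consists of lower bounds on the success probabilities [pi1] and [pi2]. At the scale of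
    [g_i], a node whose expected number [s] of active neighbours is small has [r] of them with
    probability close to [s ^ r / r!]. By the normalisation [gcrit_pow], the expected number of such
    nodes is about [kappa * y ^ r] in units of [g_i], where [y = x_i + chi_ij * x_j]; this is the
    nonlinear term of [rho]. Hence a positive [rho_i] is a surplus of the mean ([drift_ge]). The
    condition (Sup) speaks of [calD] only; [sup_quadrant] extends it to the whole quadrant and
    [sup_uniform] gives a positive gap on bounded squares, so that at every point one community has
    a surplus, and tilting that community alone is enough ([early_le]).

    For larger [T = t1 + t2], superlinearity gives a mean far above [T] ([mean_ge], [middle_le]).
    Once [T] is a positive fraction of [n], a node fails to have [r] active neighbours with
    arbitrarily small probability ([late_le]). In all three ranges the bound is at most
    [exp(- c (g_1 + T))], so the union over all types costs only a constant factor
    ([sum_sum_expR_le]). *)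

(** * Poisson-binomial tails *)

(* [pb ps k] is the probability that at least [k] of independent events of     *)
(* probabilities [ps] occur.                                                  *)
Fixpoint pb (R : realType) (ps : seq R) (k : nat) : R :=
  if ps is p :: ps' then p * pb ps' k.-1 + (1 - p) * pb ps' k
  else (k == 0)%:R.

Definition probs (R : realType) (ps : seq R) := all (fun p => 0 <= p <= 1) ps.

Lemma pb0 (R : realType) (ps : seq R) : pb ps 0 = 1.
Proof. by elim: ps => //= p ps ->; ring. Qed.

Lemma pb_ge0_le1 (R : realType) (ps : seq R) k : probs ps -> 0 <= pb ps k <= 1.
Proof.
elim: ps k => [|p ps IH] k /=; first by case: k => [|k] /=; rewrite ?lexx ler01.
by move=> /andP[hp hps]; have := IH k hps; have := IH k.-1 hps; nra.
Qed.

Lemma pb_antimono (R : realType) (ps : seq R) k :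
  probs ps -> pb ps k.+1 <= pb ps k.
Proof.
elim: ps k => [|p ps IH] k /=; first by case: k.
move=> /andP[hp hps]; have := IH k hps.
case: k => [|k] /=; first by rewrite pb0; nra.
by have := IH k hps; nra.
Qed.

Lemma pb_pred (R : realType) (ps : seq R) k : probs ps -> pb ps k <= pb ps k.-1.
Proof. by case: k => [|k] //; apply: pb_antimono. Qed.

Lemma pb_rem (R : realType) (p : R) (ps : seq R) k : p \in ps ->
  pb ps k = p * pb (rem p ps) k.-1 + (1 - p) * pb (rem p ps) k.
Proof.
elim: ps k => [//|x ps IH] k /=; rewrite inE eq_sym.
case: eqVneq => [->//|_ /= hp].
by rewrite !IH //=; ring.
Qed.

Lemma pb_perm (R : realType) (ps ps' : seq R) k :
  perm_eq ps ps' -> pb ps k = pb ps' k.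
Proof.
elim: ps ps' k => [|p ps IH] ps' k.
  by move=> /perm_size/esym/eqP; rewrite size_eq0 => /eqP->.
move=> h; have hp : p \in ps' by rewrite -(perm_mem h) mem_head.
have hr : perm_eq ps (rem p ps').
  by rewrite -(perm_cons p) (perm_trans h) // perm_to_rem.
by rewrite (pb_rem k hp) /= !(IH _ _ hr).
Qed.

Lemma pb_cons_ge (R : realType) (p : R) (ps : seq R) k :
  probs (p :: ps) -> pb ps k <= pb (p :: ps) k.
Proof. by move=> /= /andP[hp hps]; have := pb_pred k hps; nra. Qed.

Lemma pb_le (R : realType) (ps qs : seq R) k : probs ps -> probs qs ->
  all2 <=%R ps qs -> pb ps k <= pb qs k.
Proof.
elim: ps qs k => [|p ps IH] [|x qs] k //= /andP[hp hps] /andP[hx hqs].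
move=> /andP[px h]; have := IH qs k hps hqs h; have := IH qs k.-1 hps hqs h.
by have := pb_pred k hqs; nra.
Qed.


(** Ignoring some of the events can only lower the number that occur. *)
Lemma pb_subseq (R : realType) (ps qs : seq R) k : subseq ps qs -> probs qs ->
  pb ps k <= pb qs k.
Proof.
elim: qs ps k => [|x qs IH] [|p ps] k //=.
  move=> _ h; apply: (@le_trans _ _ (pb qs k)).
    by apply: (IH [::]); [rewrite sub0seq | case/andP: h].
  exact: (@pb_cons_ge R x).
case: eqVneq => [->|_] s h.
  have /andP[hx hq] := h.
  by have := IH _ k s hq; have := IH _ k.-1 s hq; nra.
apply: le_trans (IH _ k s _) (@pb_cons_ge R x qs k h).
by case/andP: h.
Qed.

Lemma pb_nseq_le (R : realType) (p : R) m n k : (m <= n)%N -> 0 <= p <= 1 ->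
  pb (nseq m p) k <= pb (nseq n p) k.
Proof.
move=> mn hp; apply: pb_subseq; last by rewrite /probs all_nseq hp orbT.
by rewrite -(subnK mn) nseqD suffix_subseq.
Qed.

(** Markov's inequality for 2^(-S), with S the number of events that occur: an event of probability
    p contributes the factor 1 - p/2 <= exp(-p/2) to the mean of 2^(-S). The induction carries this
    out one event at a time. *)
Lemma compl_pb_le (R : realType) (ps : seq R) k : probs ps ->
  1 - pb ps k <= 2 ^+ k * expR (- ((\sum_(p <- ps) p) / 2)).
Proof.
elim: ps k => [|p ps IH] k /=.
  rewrite big_nil mul0r oppr0 expR0 mulr1; case: k => [|k] /= _.
    by rewrite expr0; lra.
  by rewrite subr0 exprn_ege1 //; lra.
move=> /andP[hp hps]; rewrite big_cons.
case: k => [|k] /=; first by rewrite pb0 expr0 mul1r; have := expR_ge0 (- ((p + \sum_(j <- ps) j) / 2)); nra.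
have := IH k hps; have := IH k.+1 hps.
rewrite (_ : - ((p + _) / 2) = - (p / 2) + - ((\sum_(j <- ps) j) / 2)); last by field.
rewrite expRD exprS; set E := expR (- (_ / 2)).
have := expR_ge1Dx (- (p / 2)); set F := expR (- (p / 2)) => hF h1 h2.
have hE : 0 <= 2 ^+ k * E by rewrite mulr_ge0 // ?exprn_ge0 // expR_ge0.
rewrite (_ : 2 * 2 ^+ k * (F * E) = 2 * (F * (2 ^+ k * E))); last by ring.
rewrite -mulrA in h1.
move: hE h1 h2; set X := _ * E => hE h1 h2.
nra.
Qed.

(** * Lower bounds by elementary symmetric polynomials *)

Fixpoint esym_seq (R : realType) (k : nat) (ps : seq R) : R :=
  match k, ps with
  | 0, _ => 1
  | _.+1, [::] => 0
  | k'.+1, p :: ps' => p * esym_seq k' ps' + esym_seq k ps'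
  end.

Lemma esym_seq0 (R : realType) (ps : seq R) : esym_seq 0 ps = 1.
Proof. by case: ps. Qed.

Lemma esym_seq_ge0 (R : realType) (k : nat) (ps : seq R) :
  all (fun p => 0 <= p) ps -> 0 <= esym_seq k ps.
Proof.
elim: ps k => [|p ps IH] [|k] //= /andP[hp hps].
by rewrite addr_ge0 ?mulr_ge0 // IH.
Qed.

(** Each product of k + 1 entries arises in k + 1 ways from a product of k entries and one further
    entry, and the entries outside a given set of k sum to at least the total minus [k * m]. *)
Lemma esym_seqS_ge (R : realType) (m : R) (k : nat) (ps : seq R) :
  all (fun p => 0 <= p <= m) ps ->
  (\sum_(p <- ps) p - k%:R * m) * esym_seq k ps <= k.+1%:R * esym_seq k.+1 ps.
Proof.
elim: ps k => [|p ps IH] k /=.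
  rewrite big_nil; case: k => [|k] _; first by rewrite /=; lra.
  by rewrite /= !mulr0.
move=> /andP[hp hps]; rewrite big_cons.
have pos j : 0 <= esym_seq j ps.
  by apply: esym_seq_ge0; apply: sub_all hps => x /andP[].
have := IH k hps.
case: k => [|k]; first by rewrite /= esym_seq0; lra.
have := IH k hps; rewrite /= -![k.+2%:R]natr1 -![k.+1%:R]natr1.
have := pos k; have := pos k.+1; set s := \sum_(i <- ps) i.
set e2 := esym_seq k.+2 ps; set e1 := esym_seq k.+1 ps; set e0 := esym_seq k ps.
move=> h1 h0 i0 i1.
have /andP[pp pm] := hp.
have : 0 <= p * (m - p) * e0 by rewrite !mulr_ge0 // subr_ge0.
have : p * ((s - k%:R * m) * e0) <= p * ((k%:R + 1) * e1) by apply: ler_wpM2l.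
lra.
Qed.

Lemma esym_seq_ge (R : realType) (m : R) (r k : nat) (ps : seq R) :
  all (fun p => 0 <= p <= m) ps -> 0 <= m -> (k <= r)%N ->
  r%:R * m <= \sum_(p <- ps) p ->
  (\sum_(p <- ps) p - r%:R * m) ^+ k <= k`!%:R * esym_seq k ps.
Proof.
move=> hps m0 kr hs; elim: k kr => [|k IH] kr; first by rewrite expr0 esym_seq0 fact0 mulr1.
have hk := IH (ltnW kr).
have := esym_seqS_ge k hps.
rewrite exprS factS natrM -mulrA (mulrCA _ (k`!%:R)) => h.
have e0 : 0 <= esym_seq k ps by apply: esym_seq_ge0; apply: sub_all hps => x /andP[].
apply: le_trans (ler_wpM2l _ h); last by rewrite ler0n.
rewrite mulrCA; apply: ler_pM => //.
- by rewrite subr_ge0.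
- by rewrite exprn_ge0 // subr_ge0.
- by rewrite lerD2l lerN2 ler_wpM2r // ler_nat ltnW.
Qed.

(** For a set of k events, the probability that exactly these occur is at least their product times
    one minus the total of [ps]. Different sets give disjoint outcomes, and the products add up to
    [esym_seq k ps]. *)
Lemma pb_ge_esym (R : realType) (k : nat) (ps : seq R) : probs ps ->
  (1 - \sum_(p <- ps) p) * esym_seq k ps <= pb ps k.
Proof.
elim: ps k => [|p ps IH] k /=.
  by move=> _; rewrite big_nil; case: k => [|k] /=; lra.
move=> /andP[hp hps]; rewrite big_cons.
have pos j : 0 <= esym_seq j ps.
  by apply: esym_seq_ge0; apply: sub_all hps => x /andP[].
have s0 : 0 <= \sum_(j <- ps) j.
  by rewrite big_seq sumr_ge0 // => x xs; case/andP: (allP hps x xs).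
have hpb j := pb_ge0_le1 j hps.
case: k => [|k].
  have := hpb 0%N; rewrite /= pb0; lra.
rewrite /=; have := IH k hps; have := IH k.+1 hps.
have := hpb k; have := hpb k.+1; have := pos k; have := pos k.+1.
move: s0; set s := \sum_(j <- ps) j.
set e1 := esym_seq k.+1 ps; set e0 := esym_seq k ps; set a := pb ps k; set b := pb ps k.+1.
move=> s0 h1 h0 /andP[b0 b1] /andP[a0 a1] i1 i0; have /andP[p0 p1] := hp.
have h2 : p * ((1 - s) * e0) <= p * a by apply: ler_wpM2l.
have h3 : (1 - p) * ((1 - s) * e1) <= (1 - p) * b by apply: ler_wpM2l => //; lra.
have h4 : 0 <= p * s * e1 by rewrite !mulr_ge0.
have h5 : 0 <= p * p * e0 by rewrite !mulr_ge0.
lra.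
Qed.

(** A lower bound of the Poisson order s^r / r! for a small total s; the subtraction of [r * m] pays
    for the r events having to be distinct. *)
Lemma pb_ge (R : realType) (m : R) (r : nat) (ps : seq R) :
  all (fun p => 0 <= p <= m) ps -> 0 <= m <= 1 ->
  r%:R * m <= \sum_(p <- ps) p <= 1 ->
  (1 - \sum_(p <- ps) p) * ((\sum_(p <- ps) p - r%:R * m) ^+ r / r`!%:R)
    <= pb ps r.
Proof.
move=> hps /andP[m0 m1] /andP[hs s1].
apply: le_trans (pb_ge_esym r _); last first.
  by apply: sub_all hps => x /andP[-> xm] /=; exact: le_trans m1.
apply: ler_wpM2l; first by rewrite subr_ge0.
by rewrite ler_pdivrMr ?ltr0n ?fact_gt0 // (mulrC (esym_seq _ _)) esym_seq_ge.
Qed.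

(** * Expectation over a random edge set *)

(* Expectation over the random subset of [s] in which the elements [e] of [s]  *)
(* are kept independently with probabilities [w e].                           *)
Fixpoint Ex (R : realType) (E : finType) (w : E -> R) (s : seq E)
    (f : {set E} -> R) : R :=
  if s is e :: s' then
    w e * Ex w s' (fun g => f (e |: g)%SET) + (1 - w e) * Ex w s' f
  else f finset.set0.

Section Expectation.
Variables (R : realType) (E : finType) (w : E -> R).
Implicit Types (s : seq E) (f h : {set E} -> R).

Lemma Ex_sum s f : uniq s ->
  Ex w s f = \sum_(g : {set E} | g \subset s)
    (\prod_(e <- s) (if e \in g then w e else 1 - w e)) * f g.
Proof.
elim: s f => [|e s IH] f /=.
  move=> _; rewrite (big_pred1 finset.set0) ?big_nil ?mul1r // => g /=.
  rewrite -finset.subset0; apply: eq_subset_r => x.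
  by rewrite finset.in_set0.
move=> /andP[es us]; rewrite !IH //.
rewrite [RHS](bigID (fun g : {set E} => e \in g)) /=; congr +%R.
  rewrite [RHS](reindex_onto (fun g => e |: g)%SET (fun g => g :\ e)%SET) /=;
    last by move=> g /andP[_ eg]; rewrite finset.setD1K.
  rewrite mulr_sumr; apply: eq_big => [g|g gs].
    rewrite finset.setU11 andbT.
    apply/idP/andP => [gs|[gs /eqP <-]].
      have eg : e \notin g by apply: contra es => /(fintype.subsetP gs).
      split; last by rewrite finset.setU1K.
      apply/fintype.subsetP => x; rewrite !inE => /orP[->//|/(fintype.subsetP gs) ->].
      by rewrite orbT.
    apply/fintype.subsetP => x; rewrite finset.in_setD1 => /andP[xe xg].
    by have := fintype.subsetP gs x xg; rewrite inE (negbTE xe).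
  rewrite big_cons finset.setU11 -!mulrA; congr (_ * (_ * _)).
  apply: eq_big_seq => x xs; rewrite !inE; case: eqP => //= xe.
  by rewrite xe (negbTE es) in xs.
rewrite mulr_sumr; apply: eq_big => [g|g gs].
  apply/idP/andP => [gs|[gs eg]].
    split; last by apply: contra es => /(fintype.subsetP gs).
    by apply: (fintype.subset_trans gs); apply/fintype.subsetP => x; rewrite inE => ->; rewrite orbT.
  apply/fintype.subsetP => x xg; have := fintype.subsetP gs x xg.
  by rewrite inE => /orP[/eqP xe|//]; rewrite -xe xg in eg.
rewrite big_cons mulrA ifN //.
by apply: contra es => /(fintype.subsetP gs).
Qed.

Lemma Ex_perm s s' f : uniq s -> perm_eq s s' -> Ex w s f = Ex w s' f.
Proof.
move=> us h; have us' : uniq s' by rewrite -(perm_uniq h).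
rewrite !Ex_sum //; apply: eq_big => [g|g _].
  by apply: eq_subset_r => x; rewrite (perm_mem h).
by congr (_ * _); apply: perm_big.
Qed.

Lemma Ex_cat s s' f :
  Ex w (s ++ s') f = Ex w s (fun g => Ex w s' (fun g' => f (g :|: g')%SET)).
Proof.
elim: s f => [|e s IH] f /=; first by f_equal; apply/funext => g; rewrite finset.set0U.
rewrite !IH; congr (_ * _ + _); f_equal; apply/funext => g.
by f_equal; apply/funext => g'; rewrite finset.setUA.
Qed.

Hypothesis w01 : forall e, 0 <= w e <= 1.

Lemma Ex_le s f h : (forall g : {set E}, g \subset s -> f g <= h g) ->
  Ex w s f <= Ex w s h.
Proof.
elim: s f h => [|e s IH] f h fh /=; first by apply: fh; apply/fintype.subsetP => x; rewrite inE.
have /andP[w0 w1] := w01 e.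
have sub (g : {set E}) : g \subset s -> (e |: g)%SET \subset e :: s.
  move=> gs; apply/fintype.subsetP => x; rewrite !inE.
  by move=> /orP[->//|/(fintype.subsetP gs) ->]; rewrite orbT.
apply: lerD; apply: ler_wpM2l; rewrite ?subr_ge0 //; apply: IH => g gs; apply: fh.
  exact: sub.
exact: (fintype.subset_trans (finset.subsetUr _ _) (sub _ gs)).
Qed.

Lemma Ex_cst s (c : R) : Ex w s (fun=> c) = c.
Proof. by elim: s => //= e s ->; ring. Qed.

Lemma eq_Ex s f h : (forall g : {set E}, g \subset s -> f g = h g) ->
  Ex w s f = Ex w s h.
Proof.
move=> fh; apply/eqP; rewrite eq_le; apply/andP.
by split; apply: Ex_le => g /fh ->.
Qed.

Lemma ExZ s (c : R) f : Ex w s (fun g => c * f g) = c * Ex w s f.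
Proof. by elim: s f => //= e s IH f; rewrite !IH; ring. Qed.

(** Independence: factors that look at distinct elements can be averaged separately. It serves for
    the edges at one node, [k v] being the edge towards [v]. *)
Lemma Ex_prod (T : eqType) (vs : seq T) (k : T -> E) (h : T -> bool -> R) :
  uniq (map k vs) ->
  Ex w (map k vs) (fun g => \prod_(v <- vs) h v (k v \in g)) =
  \prod_(v <- vs) (w (k v) * h v true + (1 - w (k v)) * h v false).
Proof.
elim: vs => [|v vs IH] /=; first by rewrite !big_nil.
move=> /andP[kv us]; rewrite big_cons -IH // [RHS]mulrDl -!mulrA -(ExZ _ (h v true)) -(ExZ _ (h v false)).
congr (_ * _ + _ * _); apply: eq_Ex => g gs; rewrite big_cons.
  rewrite finset.setU11; congr (_ * _); apply: eq_big_seq => x xs.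
  rewrite finset.in_setU1; case: eqP => // kx.
  by rewrite -kx map_f in kv.
congr (h v _ * _); apply/negbTE; apply: contra kv.
exact: (fintype.subsetP gs).
Qed.

End Expectation.

(** * Percolation with thresholds *)

Section Thresholds.
Variable V : finType.
Implicit Types (U A B : {set V}) (g : {set {set V}}) (tau : V -> nat).

Definition tclosed U tau g B : bool :=
  [forall v in U, (tau v <= #|[set x in B | adj g x v]%SET|)%N ==> (v \in B)].

(* [A] is the final active set of the percolation on [U] in which [v] becomes *)
(* active as soon as it has [tau v] active neighbours.                        *)
Definition tfinal U tau g A : bool :=
  [&& A \subset U, tclosed U tau g A &
      [forall B : {set V}, (B \subset U) && tclosed U tau g B ==> (A \subset B)]].

Definition pairs_in U : {set {set V}} := [set e in pairs V | e \subset U]%SET.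

(** A seed is a node of threshold 0, so that seeds and later activations obey one rule; this makes
    the induction of [Ex_tfinal_le] possible, where revealed edges lower thresholds. *)
Lemma bp_final_tfinal r g (S : {set V}) :
  tfinal [set: V]%SET (fun v => if v \in S then 0 else r)%N g (bp_final r g S).
Proof.
have sS : S \subset bp_final r g S.
  rewrite /bp_final; elim: #|V| => //= n IH.
  exact: (fintype.subset_trans IH (finset.subsetUl _ _)).
apply/and3P; split; first exact: finset.subsetT.
  apply/forall_inP => v _; apply/implyP; case: ifP => [vS _|_ h].
    exact: (fintype.subsetP sS).
  by rewrite -bp_final_stable /bp_step finset.in_setU finset.in_set h orbT.
apply/forallP => B; apply/implyP => /andP[_ /forall_inP clB].
have SB : S \subset B.
  apply/fintype.subsetP => v vS; have /implyP := clB v (finset.in_setT v).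
  by rewrite vS; apply.
rewrite /bp_final; elim: #|V| => //= n IH.
apply/fintype.subsetP => v; rewrite /bp_step finset.in_setU => /orP[|].
  exact: (fintype.subsetP IH).
rewrite finset.in_set => h; have /implyP := clB v (finset.in_setT v).
apply; case: ifP => // _; apply: leq_trans h _; apply: subset_leq_card.
apply/fintype.subsetP => x; rewrite !finset.in_set => /andP[xi ->].
by rewrite andbT; exact: (fintype.subsetP IH).
Qed.

Definition star U (u : V) : seq {set V} :=
  [seq [set u; v]%SET | v <- enum (U :\ u)%SET].

Lemma set2_inj (u : V) : injective (fun v => [set u; v]%SET).
Proof.
move=> v v' h.
have : v \in [set u; v']%SET by rewrite -h finset.set22.
have : v' \in [set u; v]%SET by rewrite h finset.set22.
rewrite !finset.in_set2 => /orP[/eqP->|/eqP->//].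
by rewrite orbb => /eqP.
Qed.

Lemma star_uniq U u : uniq (star U u).
Proof. by rewrite map_inj_uniq ?enum_uniq //; exact: set2_inj. Qed.

Lemma pairs_in_split U u : u \in U ->
  perm_eq (enum (pairs_in U)) (star U u ++ enum (pairs_in (U :\ u)%SET)).
Proof.
move=> uU; apply: uniq_perm; first exact: enum_uniq.
  rewrite cat_uniq star_uniq enum_uniq andbT /=.
  apply/hasPn => e; rewrite mem_enum !inE => /andP[_ eU]; apply/negP.
  move=> /mapP[v _ ev]; have := fintype.subsetP eU u.
  by rewrite ev finset.set21 finset.in_setD1 eqxx => /(_ isT).
move=> e; rewrite mem_cat !mem_enum !finset.in_set.
apply/andP/orP => [[/cards2P[a [b [ab ->]]] eU]|].
  have aU : a \in U by apply: (fintype.subsetP eU); rewrite finset.set21.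
  have bU : b \in U by apply: (fintype.subsetP eU); rewrite finset.set22.
  have [ua|ua] := eqVneq u a.
    by left; rewrite -ua; apply/mapP; exists b => //; rewrite mem_enum finset.in_setD1 bU ua eq_sym ab.
  have [ub|ub] := eqVneq u b.
    left; rewrite finset.setUC -ub; apply/mapP; exists a => //.
    by rewrite mem_enum finset.in_setD1 aU ub ab.
  right; rewrite cards2 ab /=; apply/fintype.subsetP => x.
  by rewrite finset.in_set2 finset.in_setD1 => /orP[]/eqP->; rewrite eq_sym ?ua ?ub.
case=> [/mapP[v]|/andP[-> eU]].
  rewrite mem_enum finset.in_setD1 => /andP[vu vU] ->.
  rewrite cards2 (eq_sym u) vu; split => //; apply/fintype.subsetP => x.
  by rewrite finset.in_set2 => /orP[]/eqP->.
by split => //; apply: (fintype.subset_trans eU); exact: subD1set.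
Qed.

Section Reveal.
Variables (U : {set V}) (u : V) (tau : V -> nat) (g g' : {set {set V}}).
Hypotheses (uU : u \in U) (tau0 : tau u = 0%N).
Hypotheses (gs : g \subset star U u) (gs' : g' \subset enum (pairs_in (U :\ u)%SET)).

Let tau' v := (tau v - ([set u; v]%SET \in g))%N.

(** The active node [u] counts as one neighbour for exactly those [v] with an edge to [u] in [g],
    and this one can be moved from the count to the threshold. Truncated subtraction is right here:
    a threshold that is already 0 stays met. *)
Lemma tclosed_reveal B : B \subset (U :\ u)%SET ->
  tclosed U tau (g :|: g')%SET (u |: B)%SET = tclosed (U :\ u)%SET tau' g' B.
Proof.
move=> BU.
have uB : u \notin B.
  by apply/negP => /(fintype.subsetP BU); rewrite finset.in_setD1 eqxx.
have notg x v : x != u -> v != u -> [set x; v]%SET \notin g.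
  move=> xu vu; apply/negP => /(fintype.subsetP gs) /mapP[y _ h].
  have : u \in [set x; v]%SET by rewrite h finset.set21.
  by rewrite finset.in_set2 eq_sym (negbTE xu) eq_sym (negbTE vu).
have notg' v : [set u; v]%SET \notin g'.
  apply/negP => /(fintype.subsetP gs'); rewrite mem_enum finset.in_set => /andP[_].
  by move=> /fintype.subsetP/(_ u); rewrite finset.set21 finset.in_setD1 eqxx => /(_ isT).
have card v : v != u ->
  #|[set x in (u |: B)%SET | adj (g :|: g')%SET x v]%SET| =
  (([set u; v]%SET \in g) + #|[set x in B | adj g' x v]%SET|)%N.
  move=> vu; rewrite (cardsD1 u); congr (nat_of_bool _ + _)%N.
    by rewrite !inE eqxx /= /adj eq_sym vu finset.in_setU (negbTE (notg' v)) orbF.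
  congr #|pred_of_set _|; apply/setP => x; rewrite !inE.
  case: eqVneq => [->|xu] /=; first by rewrite (negbTE uB).
  by rewrite /adj finset.in_setU (negbTE (notg x v xu vu)).
apply/forall_inP/forall_inP => h v.
  rewrite finset.in_setD1 => /andP[vu vU]; have := h v vU.
  by rewrite card // -leq_subLR finset.in_setU1 (negbTE vu).
move=> vU; have [->|vu] := eqVneq v u; first by rewrite finset.setU11 implybT.
have := h v; rewrite finset.in_setD1 vu vU => /(_ isT).
by rewrite card // -leq_subLR finset.in_setU1 (negbTE vu).
Qed.

(** Minimality passes to the smaller node set because a closed [B] there becomes a closed set of [U]
    when [u] is added. *)
Lemma tfinal_reveal A : tfinal U tau (g :|: g')%SET A ->
  u \in A /\ tfinal (U :\ u)%SET tau' g' (A :\ u)%SET.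
Proof.
move=> /and3P[AU clA /forallP minA].
have uA : u \in A by have /forall_inP/(_ u uU) := clA; rewrite tau0.
have AuU : (A :\ u)%SET \subset (U :\ u)%SET by exact: finset.setSD.
split => //; apply/and3P; split => //.
  by rewrite -tclosed_reveal // finset.setD1K.
apply/forallP => B; apply/implyP => /andP[BU clB].
have := minA (u |: B)%SET; rewrite tclosed_reveal // clB andbT => /implyP h.
have AB : A \subset (u |: B)%SET.
  apply: h; apply/fintype.subsetP => y; rewrite finset.in_setU1 => /orP[/eqP->//|yB].
  by have := fintype.subsetP BU y yB; rewrite finset.in_setD1 => /andP[].
apply/fintype.subsetP => x; rewrite finset.in_setD1 => /andP[xu xA].
by have := fintype.subsetP AB x xA; rewrite finset.in_setU1 (negbTE xu).
Qed.

End Reveal.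
End Thresholds.

(** The entry 0 at [x = v] reflects that a node is not its own neighbour; it matters when [v] lies
    in [A]. *)
Definition hit_prob (R : realType) (V : finType) (w : {set V} -> R)
    (A : {set V}) (v : V) (k : nat) : R :=
  pb [seq if x == v then 0 else w [set x; v]%SET | x <- enum A] k.

Section FinalSet.
Variables (R : realType) (V : finType) (w : {set V} -> R).
Hypothesis w01 : forall e, 0 <= w e <= 1.
Implicit Types (U A : {set V}) (tau : V -> nat).

Lemma hit_prob_ge0_le1 A v k : 0 <= hit_prob w A v k <= 1.
Proof.
apply: pb_ge0_le1; rewrite /probs all_map; apply/allP => x _ /=.
by case: eqP => // _; rewrite lexx ler01.
Qed.

Lemma hit_probD1 A u v k : u \in A -> v != u ->
  hit_prob w A v k =
    w [set u; v]%SET * hit_prob w (A :\ u)%SET v k.-1 +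
    (1 - w [set u; v]%SET) * hit_prob w (A :\ u)%SET v k.
Proof.
move=> uA vu.
have h : perm_eq (enum A) (u :: enum (A :\ u)%SET).
  apply: uniq_perm; rewrite /= ?enum_uniq // ?mem_enum ?finset.in_setD1 ?eqxx //.
  by move=> x; rewrite inE !mem_enum finset.in_setD1; case: eqVneq => [->|].
by rewrite {1}/hit_prob (pb_perm _ (perm_map _ h)) /= eq_sym (negbTE vu).
Qed.

(* Reveal the edges at a node [u] of threshold 0: [u] is active, the threshold *)
(* of [v] drops by one when [uv] is an edge, and the edges inside [U :\ u] are  *)
(* still fresh. Thus an edge inside [A] is used for one of its ends only, and  *)
(* the nodes become active as if they had independent neighbourhoods.          *)
Lemma Ex_tfinal_le U A tau : A \subset U ->
  Ex w (enum (pairs_in U)) (fun g => (tfinal U tau g A)%:R) <=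
  \prod_(v in U) (if v \in A then hit_prob w A v (tau v)
                  else 1 - hit_prob w A v (tau v)).
Proof.
have [n] := ubnP #|U|; elim: n U A tau => // n IH U A tau; rewrite ltnS => Un AU.
have rhs0 : 0 <= \prod_(v in U) (if v \in A then hit_prob w A v (tau v)
                  else 1 - hit_prob w A v (tau v)).
  apply: prodr_ge0 => v _; have /andP[? ?] := hit_prob_ge0_le1 A v (tau v).
  by case: ifP; rewrite ?subr_ge0.
(* Without a node of threshold 0 the empty set is closed, so only an empty [A] can be final, and
   then every factor of the product is 1. *)
have [/existsP[u /andP[uU /eqP tau0]]|/existsPn no0] :=
  boolP [exists u, (u \in U) && (tau u == 0%N)]; last first.
  have [A0|A0] := eqVneq A finset.set0.
    rewrite big1 => [|v vU]; last first.
      rewrite A0 finset.in_set0 /hit_prob finset.enum_set0 /=.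
      by have := no0 v; rewrite vU => /= /negbTE->; rewrite subr0.
    rewrite -[leRHS](Ex_cst w (enum (pairs_in U)) 1); apply: Ex_le => // g _.
    by case: (tfinal _ _ _ _); rewrite ?lexx ?ler01.
  apply: le_trans rhs0; rewrite -[leRHS](Ex_cst w (enum (pairs_in U)) 0).
  apply: Ex_le => // g _; case: (boolP (tfinal _ _ _ _)) => //.
  move=> /and3P[_ _ /forallP/(_ finset.set0)].
  rewrite finset.sub0set finset.subset0 (negbTE A0) implybF => /negP[].
  apply/forall_inP => v vU; apply/implyP.
  have := no0 v; rewrite vU /= -lt0n => tv h; exfalso; move: h; apply/negP.
  rewrite -ltnNge (_ : finset.finset _ = finset.set0) ?cards0 //.
  by apply/setP => x; rewrite !inE.
have [uA|uA] := boolP (u \in A); last first.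
  apply: le_trans rhs0; rewrite -[leRHS](Ex_cst w (enum (pairs_in U)) 0).
  apply: Ex_le => // g _; case: (boolP (tfinal _ _ _ _)) => // /and3P[_ /forall_inP/(_ u uU)].
  by rewrite tau0 (negbTE uA).
rewrite (Ex_perm _ _ (enum_uniq _) (pairs_in_split uU)) Ex_cat.
(* [h v b] is the factor of [v] once it is known whether [uv] is an edge ([b]). Averaging over [b]
   restores the factor of [v] with respect to [A], by [hit_probD1], and the factor of [u] itself is
   1. *)
pose h v b := if v \in A then hit_prob w (A :\ u)%SET v (tau v - b)
              else 1 - hit_prob w (A :\ u)%SET v (tau v - b).
pose W := enum (U :\ u)%SET.
apply: (@le_trans _ _ (Ex w (star U u)
    (fun g => \prod_(v <- W) h v ([set u; v]%SET \in g)))).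
  apply: Ex_le => // g gs.
  pose tau' v := (tau v - ([set u; v]%SET \in g))%N.
  apply: (@le_trans _ _ (Ex w (enum (pairs_in (U :\ u)%SET))
      (fun g' => (tfinal (U :\ u)%SET tau' g' (A :\ u)%SET)%:R))).
    apply: Ex_le => // g' gs'; rewrite ler_nat; case: (boolP (tfinal U _ _ _)) => //.
    by move=> /(tfinal_reveal uU tau0 gs gs')[_ ->].
  apply: le_trans (IH _ _ _ _ _) _.
  - by apply: leq_trans Un; rewrite [leqRHS](cardsD1 u) uU.
  - exact: finset.setSD.
  rewrite /W big_enum /= le_eqVlt; apply/orP; left; apply/eqP.
  apply: eq_bigr => v; rewrite finset.in_setD1 => /andP[vu vU].
  by rewrite finset.in_setD1 vu.
rewrite /star (@Ex_prod _ _ w w01 _ W (fun v => [set u; v]%SET) h (star_uniq U u)).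
rewrite /W big_enum [leRHS](big_setD1 u) //= uA tau0.
rewrite {1}/hit_prob pb0 mul1r le_eqVlt; apply/orP; left; apply/eqP.
apply: eq_bigr => v; rewrite finset.in_setD1 => /andP[vu vU].
rewrite /h subn1 subn0; case: ifP => _; first by rewrite -hit_probD1.
by rewrite (hit_probD1 (tau v) uA vu); ring.
Qed.

End FinalSet.

(** * Number of active nodes in the two communities *)

(* The exponential-tilting bound on the probability that the percolation stops *)
(* with [t1] and [t2] active nodes in the two communities: [pi_i] is the       *)
(* probability that a node of community [i] has [r] neighbours among these,    *)
(* and the [z_i] are free.                                                     *)
Definition stop_bound (R : realType) (n1 n2 a1 a2 t1 t2 : nat)
    (pi_1 pi_2 z1 z2 : R) : R :=
  (z1 ^+ (t1 - a1) * z2 ^+ (t2 - a2))^-1 *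
  ((1 - pi_1 * (1 - z1)) ^+ (n1 - a1) * (1 - pi_2 * (1 - z2)) ^+ (n2 - a2)).

Lemma stop_boundE (R : realType) (n1 n2 a1 a2 t1 t2 : nat) (pi_1 pi_2 z1 z2 : R) :
  stop_bound n1 n2 a1 a2 t1 t2 pi_1 pi_2 z1 z2 =
  (z1 ^+ (t1 - a1))^-1 * (1 - pi_1 * (1 - z1)) ^+ (n1 - a1) *
  ((z2 ^+ (t2 - a2))^-1 * (1 - pi_2 * (1 - z2)) ^+ (n2 - a2)).
Proof. by rewrite /stop_bound invfM mulrACA. Qed.

Lemma perm_map_if (R : eqType) (T : Type) (a : pred T) (x y : R) (s : seq T) :
  perm_eq [seq if a t then x else y | t <- s]
          (nseq (count a s) x ++ nseq (count (predC a) s) y).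
Proof.
elim: s => //= t s IH; case: (a t) => /=; first by rewrite perm_cons.
rewrite !add0n perm_sym -(cat1s y (nseq _ _)) perm_catCA /= perm_cons perm_sym.
exact: IH.
Qed.

Section TypeSum.
Variables (R : realType) (n1 n2 : nat) (p1 p2 q : R) (r : nat).
Hypotheses (hp1 : 0 <= p1 <= 1) (hp2 : 0 <= p2 <= 1) (hq : 0 <= q <= 1).

Local Notation V := (sbm_node n1 n2).
Local Notation w := (@edge_prob R n1 n2 p1 p2 q).
Implicit Types (A S : {set V}).

Definition is_inl (v : sbm_node n1 n2) : bool := if v is inl _ then true else false.

Definition ncom1 (A : {set sbm_node n1 n2}) := #|[set v in A | is_inl v]%SET|.
Definition ncom2 (A : {set sbm_node n1 n2}) := #|[set v in A | ~~ is_inl v]%SET|.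

Lemma ncomD A : #|A| = (ncom1 A + ncom2 A)%N.
Proof.
rewrite /ncom1 /ncom2 -!sum1_card (bigID is_inl) /=.
by congr addn; apply: eq_bigl => v; rewrite finset.in_set.
Qed.

Lemma count_enum1 A : count is_inl (enum A) = ncom1 A.
Proof.
rewrite -sum1_count big_enum_cond /= /ncom1 -sum1_card.
by apply: eq_bigl => v; rewrite finset.in_set.
Qed.

Lemma count_enum2 A : count (predC is_inl) (enum A) = ncom2 A.
Proof.
rewrite -sum1_count big_enum_cond /= /ncom2 -sum1_card.
by apply: eq_bigl => v; rewrite finset.in_set.
Qed.

Definition pi1 (t1 t2 : nat) : R := pb (nseq t1 p1 ++ nseq t2 q) r.
Definition pi2 (t1 t2 : nat) : R := pb (nseq t1 q ++ nseq t2 p2) r.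
Definition pi_at (v : sbm_node n1 n2) (t1 t2 : nat) : R :=
  if is_inl v then pi1 t1 t2 else pi2 t1 t2.

Lemma edge_prob_ge0_le1 (e : {set V}) : 0 <= w e <= 1.
Proof. by rewrite /edge_prob; case: ifP => // _; case: ifP. Qed.

Lemma pair_sub1 (x v : V) :
  ([set x; v]%SET \subset community1 n1 n2) = is_inl x && is_inl v.
Proof.
have in1 (y : V) : (y \in community1 n1 n2) = is_inl y.
  case: y => i /=; first by rewrite imset_f.
  by apply/negbTE/imsetP => -[].
by rewrite finset.subUset !finset.sub1set !in1.
Qed.

Lemma pair_sub2 (x v : V) :
  ([set x; v]%SET \subset community2 n1 n2) = ~~ is_inl x && ~~ is_inl v.
Proof.
have in2 (y : V) : (y \in community2 n1 n2) = ~~ is_inl y.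
  case: y => i /=; last by rewrite imset_f.
  by apply/negbTE/imsetP => -[].
by rewrite finset.subUset !finset.sub1set !in2.
Qed.

Lemma edge_probE (x v : V) : w [set x; v]%SET =
  if is_inl x then (if is_inl v then p1 else q) else (if is_inl v then q else p2).
Proof.
by rewrite /edge_prob pair_sub1 pair_sub2; case: (is_inl x); case: (is_inl v).
Qed.

Lemma pi_at_ge0_le1 v t1 t2 : 0 <= pi_at v t1 t2 <= 1.
Proof.
rewrite /pi_at; case: ifP => _; apply: pb_ge0_le1;
by rewrite /probs all_cat !all_nseq ?hp1 ?hp2 ?hq !orbT.
Qed.

Lemma pi_atE A v : pi_at v (ncom1 A) (ncom2 A) =
  pb [seq w [set x; v]%SET | x <- enum A] r.
Proof.
rewrite (eq_map (fun x => edge_probE x v)).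
rewrite (pb_perm _ (perm_map_if is_inl _ _ _)) count_enum1 count_enum2 /pi_at.
by case: ifP.
Qed.

(** For [v] in [A] the right-hand side also counts [v] as a possible neighbour of itself. An upper
    bound suffices for active nodes. *)
Lemma hit_prob_le A v : hit_prob w A v r <= pi_at v (ncom1 A) (ncom2 A).
Proof.
have w01 := edge_prob_ge0_le1.
rewrite pi_atE /hit_prob; apply: pb_le; rewrite /probs ?all_map.
- by apply/allP => x _ /=; case: ifP; rewrite ?lexx ?ler01.
- by apply/allP => x _ /=.
- elim: (enum A) => //= x s ->; rewrite andbT; case: ifP => // _.
  by case/andP: (w01 [set x; v]%SET).
Qed.

(** Inactive nodes enter through one minus this probability, where the inequality [hit_prob_le]
    would point the wrong way. *)
Lemma hit_prob_notin A v : v \notin A ->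
  hit_prob w A v r = pi_at v (ncom1 A) (ncom2 A).
Proof.
move=> vA; rewrite pi_atE /hit_prob; congr (pb _ _).
apply/eq_in_map => x; rewrite mem_enum => xA.
by case: eqVneq => // xv; rewrite xv (negbTE vA) in xA.
Qed.

(* On the sets [A] of the given type, the weight [z1] or [z2] put on each active *)
(* node that is not a seed is a constant factor; once it is in, the sum over   *)
(* all [A] factors over the nodes.                                            *)
Lemma type_sum_le S t1 t2 (z1 z2 : R) : 0 < z1 <= 1 -> 0 < z2 <= 1 ->
  \sum_(A : {set V} | (ncom1 A == t1) && (ncom2 A == t2))
    \prod_v (if v \in A then hit_prob w A v (if v \in S then 0 else r)%N
             else 1 - hit_prob w A v (if v \in S then 0 else r)%N)
  <= if (ncom1 S <= t1)%N && (ncom2 S <= t2)%N then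
       stop_bound n1 n2 (ncom1 S) (ncom2 S) t1 t2 (pi1 t1 t2) (pi2 t1 t2) z1 z2
     else 0.
Proof.
move=> /andP[z10 z11] /andP[z20 z21].
pose f A := \prod_v (if v \in A then hit_prob w A v (if v \in S then 0 else r)%N
             else 1 - hit_prob w A v (if v \in S then 0 else r)%N).
(* A seed outside [A] has threshold 0, so its factor is 1 - 1. *)
have f0 A : ~~ (S \subset A) -> f A = 0.
  move=> /fintype.subsetPn[v vS vA]; rewrite /f (bigD1 v) //= (negbTE vA) vS.
  by rewrite /hit_prob pb0 subrr mul0r.
rewrite (bigID (fun A : {set V} => S \subset A)) /= [X in _ + X]big1 ?addr0; last first.
  by move=> A /andP[_ /f0].
case: ifPn => [/andP[at1 at2]|nat12]; last first.
  rewrite big1 // => A /andP[/andP[/eqP tA1 /eqP tA2] SA]; case/negP: nat12.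
  rewrite -tA1 -tA2; apply/andP; split; apply: subset_leq_card.
    by apply/fintype.subsetP => v; rewrite !finset.in_set => /andP[/(fintype.subsetP SA)-> ->].
  by apply/fintype.subsetP => v; rewrite !finset.in_set => /andP[/(fintype.subsetP SA)-> ->].
(* In the factored sum a seed contributes 1, and any other node contributes z pi + (1 - pi) = 1 - pi
   (1 - z). *)
pose zeta v := if v \in S then 1 else if is_inl v then z1 else z2.
pose Gt v := if v \in S then 1 else pi_at v t1 t2.
pose Gf v := if v \in S then 0 else 1 - pi_at v t1 t2.
have Gt0 v : 0 <= Gt v.
  by rewrite /Gt; case: ifP => // _; case/andP: (pi_at_ge0_le1 v t1 t2).
have Gf0 v : 0 <= Gf v.
  by rewrite /Gf; case: ifP => // _; rewrite subr_ge0; case/andP: (pi_at_ge0_le1 v t1 t2).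
have ze0 v : 0 < zeta v by rewrite /zeta; case: ifP => // _; case: ifP.
rewrite /stop_bound; set c := z1 ^+ _ * _.
have c0 : 0 < c by rewrite mulr_gt0 // exprn_gt0.
apply: (@le_trans _ _ (c^-1 * \sum_(A : {set V})
    \prod_v (if v \in A then zeta v * Gt v else Gf v))).
  rewrite mulr_sumr [leRHS](bigID (fun A : {set V} => (ncom1 A == t1) && (ncom2 A == t2) && (S \subset A))) /=.
  rewrite -[leLHS]addr0; apply: lerD; last first.
    apply: sumr_ge0 => A _; rewrite mulr_ge0 ?invr_ge0 ?(ltW c0) // prodr_ge0 // => v _.
    by case: ifP => _ //; rewrite mulr_ge0 // ltW.
  apply: ler_sum => A /andP[/andP[/eqP tA1 /eqP tA2] SA].
  have -> : \prod_v (if v \in A then zeta v * Gt v else Gf v) =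
      c * \prod_v (if v \in A then Gt v else Gf v).
    transitivity (\prod_v ((if v \in A then zeta v else 1) * (if v \in A then Gt v else Gf v))).
      by apply: eq_bigr => v _; case: ifP => // _; rewrite mul1r.
    rewrite big_split /=; congr (_ * _).
    rewrite -big_mkcond /= (bigID (mem S)) /= big1 ?mul1r; last first.
      by move=> v /andP[_ vS]; rewrite /zeta vS.
    rewrite (bigID is_inl) /= /c.
    rewrite (eq_bigr (fun=> z1)); last first.
      by move=> v /andP[/andP[_ /negbTE vS] vl]; rewrite /zeta vS vl.
    rewrite prodr_const (eq_bigr (fun=> z2)); last first.
      by move=> v /andP[/andP[_ /negbTE vS] /negbTE vl]; rewrite /zeta vS vl.
    rewrite prodr_const -tA1 -tA2 /ncom1 /ncom2.
    congr (_ ^+ _ * _ ^+ _).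
      rewrite -cardsDS.
        apply: eq_card => v; transitivity ((v \in A) && (v \notin S) && is_inl v) => //.
        by rewrite !inE; case: (v \in A); case: (v \in S); case: (is_inl v).
      by apply/fintype.subsetP => v; rewrite !finset.in_set => /andP[/(fintype.subsetP SA)-> ->].
    rewrite -cardsDS.
      apply: eq_card => v; transitivity ((v \in A) && (v \notin S) && ~~ is_inl v) => //.
      by rewrite !inE; case: (v \in A); case: (v \in S); case: (is_inl v).
    by apply/fintype.subsetP => v; rewrite !finset.in_set => /andP[/(fintype.subsetP SA)-> ->].
  rewrite mulKf ?gt_eqF //; apply: ler_prod => v _.
  have w01 := edge_prob_ge0_le1.
  case: ifPn => vA; rewrite /Gt /Gf.
    have /andP[-> h] := hit_prob_ge0_le1 w01 A v (if v \in S then 0 else r)%N.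
    by case: ifP h => //= _ _; rewrite -tA1 -tA2 hit_prob_le.
  case: ifP => vS; first by rewrite (fintype.subsetP SA v vS) in vA.
  by rewrite hit_prob_notin // tA1 tA2 lexx andbT subr_ge0; case/andP: (pi_at_ge0_le1 v t1 t2).
apply: ler_wpM2l; first by rewrite invr_ge0 ltW.
rewrite -bigA_distr /= le_eqVlt; apply/orP; left; apply/eqP.
have prodE (a : pred V) (x : R) :
    \prod_(v | a v) (if v \in S then 1 else x) =
    x ^+ (#|[set v | a v]%SET| - #|[set v in S | a v]%SET|).
  rewrite (bigID (mem S)) /= big1 ?mul1r; last by move=> v /andP[_ ->].
  rewrite (eq_bigr (fun=> x)); last by move=> v /andP[_ /negbTE->].
  rewrite prodr_const -cardsDS.
    congr (_ ^+ _); apply: eq_card => v; transitivity (a v && (v \notin S)) => //.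
    by rewrite !inE; case: (a v); case: (v \in S).
  by apply/fintype.subsetP => v; rewrite !finset.in_set => /andP[].
have card_inl : #|[set v : V | is_inl v]%SET| = n1.
  rewrite -[RHS]card_ord -(card_imset _ (@inl_inj 'I_n1 'I_n2)).
  apply: eq_card => -[i|i]; rewrite !inE /=; first by rewrite imset_f.
  by apply/esym/negbTE/imsetP => -[].
have card_inr : #|[set v : V | ~~ is_inl v]%SET| = n2.
  rewrite -[RHS]card_ord -(card_imset _ (@inr_inj 'I_n1 'I_n2)).
  apply: eq_card => -[i|i]; rewrite !inE /=; last by rewrite imset_f.
  by apply/esym/negbTE/imsetP => -[].
rewrite -[in RHS]card_inl -[X in _ * _ ^+ (X - _)]card_inr -!prodE.
rewrite (bigID is_inl) /=; congr (_ * _); apply: eq_bigr => v.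
  by move=> vl; rewrite /zeta /Gt /Gf /pi_at vl; case: ifP => _; ring.
by move=> /negbTE vl; rewrite /zeta /Gt /Gf /pi_at vl; case: ifP => _; ring.
Qed.

End TypeSum.

Section FinalSize.
Variables (R : realType) (n1 n2 : nat) (p1 p2 q : R) (r : nat).
Hypotheses (hp1 : 0 <= p1 <= 1) (hp2 : 0 <= p2 <= 1) (hq : 0 <= q <= 1).

Local Notation V := (sbm_node n1 n2).
Local Notation w := (@edge_prob R n1 n2 p1 p2 q).

Lemma sum_sbm_Ex (f : {set {set V}} -> R) :
  \sum_g sbm_pmf p1 p2 q g * f g = Ex w (enum (pairs_in [set: V]%SET)) f.
Proof.
have pT : pairs_in [set: V]%SET = pairs V.
  by apply/setP => e; rewrite finset.in_set finset.subsetT andbT.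
rewrite pT Ex_sum ?enum_uniq // [RHS]big_mkcond /=; apply: eq_bigr => g _.
rewrite /sbm_pmf (_ : (g \subset enum (pairs V)) = (g \subset pairs V)); last first.
  by apply: eq_subset_r => x; rewrite mem_enum.
by case: ifP => _; rewrite ?mul0r // big_enum.
Qed.

Lemma ncom1_seeds (S1 : {set 'I_n1}) (S2 : {set 'I_n2}) :
  ncom1 ([set inl i | i in S1] :|: [set inr i | i in S2] : {set V})%SET = #|S1|.
Proof.
rewrite -(card_imset _ (@inl_inj 'I_n1 'I_n2)) /ncom1.
apply: eq_card => -[i|i]; rewrite !inE /= ?andbT ?andbF.
  by rewrite orb_idr // => /imsetP[].
by apply/esym/negbTE/imsetP => -[].
Qed.

Lemma ncom2_seeds (S1 : {set 'I_n1}) (S2 : {set 'I_n2}) :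
  ncom2 ([set inl i | i in S1] :|: [set inr i | i in S2] : {set V})%SET = #|S2|.
Proof.
rewrite -(card_imset _ (@inr_inj 'I_n1 'I_n2)) /ncom2.
apply: eq_card => -[i|i]; rewrite !inE /= ?andbT ?andbF.
  by apply/esym/negbTE/imsetP => -[].
by rewrite orb_idl // => /imsetP[].
Qed.

Lemma ncom1_le (A : {set V}) : (ncom1 A <= n1)%N.
Proof.
rewrite -[leqRHS]card_ord -(card_imset _ (@inl_inj 'I_n1 'I_n2)).
apply: subset_leq_card; apply/fintype.subsetP => -[i|i]; rewrite !finset.in_set /=.
  by rewrite imset_f.
by rewrite andbF.
Qed.

Lemma ncom2_le (A : {set V}) : (ncom2 A <= n2)%N.
Proof.
rewrite -[leqRHS]card_ord -(card_imset _ (@inr_inj 'I_n1 'I_n2)).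
apply: subset_leq_card; apply/fintype.subsetP => -[i|i]; rewrite !finset.in_set /=.
  by rewrite andbF.
by rewrite imset_f.
Qed.

(** For fixed seeds the event is split according to the final set, and the final sets according to
    their type. The resulting bound depends on the seeds only through their numbers, so averaging
    over the seeds preserves it. *)
Lemma Pr_final_le (a1 a2 : nat) (B : pred nat) (beta : nat -> nat -> R) :
  (a1 <= n1)%N -> (a2 <= n2)%N ->
  (forall t1 t2, 0 <= beta t1 t2) ->
  (forall t1 t2, (a1 <= t1 <= n1)%N -> (a2 <= t2 <= n2)%N -> B (t1 + t2)%N ->
    exists z1 z2 : R, [/\ 0 < z1 <= 1, 0 < z2 <= 1 &
       stop_bound n1 n2 a1 a2 t1 t2 (pi1 p1 q r t1 t2) (pi2 p2 q r t1 t2) z1 z2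
         <= beta t1 t2]) ->
  Pr p1 p2 q a1 a2 (fun w : outcome n1 n2 => B #|final_active r w|) <=
    \sum_(t1 < n1.+1) \sum_(t2 < n2.+1) beta t1 t2.
Proof.
move=> h1 h2 beta0 hbeta; set M := (X in _ <= X).
have w01 : forall e, 0 <= w e <= 1 by exact: edge_prob_ge0_le1.
(* The conditional probability of the event given the seeds. *)
pose L (S1 : {set 'I_n1}) (S2 : {set 'I_n2}) := \sum_g sbm_pmf p1 p2 q g *
  (B #|bp_final r g ([set inl i | i in S1] :|: [set inr i | i in S2] : {set V})%SET|)%:R.
have LM (S1 : {set 'I_n1}) (S2 : {set 'I_n2}) : #|S1| = a1 -> #|S2| = a2 -> L S1 S2 <= M.
  move=> c1 c2; rewrite /L; set S := finset.setU _ _.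
  have cS1 : ncom1 S = a1 by rewrite ncom1_seeds.
  have cS2 : ncom2 S = a2 by rewrite ncom2_seeds.
  pose F (A : {set V}) := \prod_v (if v \in A then hit_prob w A v (if v \in S then 0 else r)%N
             else 1 - hit_prob w A v (if v \in S then 0 else r)%N).
  have F0 A : 0 <= F A.
    apply: prodr_ge0 => v _; have /andP[? ?] := hit_prob_ge0_le1 w01 A v (if v \in S then 0 else r)%N.
    by case: (v \in A); rewrite ?subr_ge0.
  apply: (@le_trans _ _ (\sum_(A : {set V} | B #|A|) F A)).
    have -> : \sum_g sbm_pmf p1 p2 q g * (B #|bp_final r g S|)%:R =
        \sum_(A : {set V} | B #|A|) \sum_g sbm_pmf p1 p2 q g * (bp_final r g S == A)%:R.
      rewrite exchange_big /=; apply: eq_bigr => g _; rewrite -mulr_sumr; congr (_ * _).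
      case: (boolP (B _)) => hB.
        rewrite (bigD1 (bp_final r g S)) //= eqxx big1 ?addr0 // => A /andP[_].
        by rewrite eq_sym => /negbTE->.
      rewrite big1 // => A hA; case: eqP => // E.
      by rewrite E hA in hB.
    apply: ler_sum => A _; rewrite sum_sbm_Ex.
    apply: le_trans (_ : Ex w (enum (pairs_in [set: V]%SET))
       (fun g => (tfinal [set: V]%SET (fun v => if v \in S then 0 else r)%N g A)%:R) <= _).
      apply: Ex_le => // g _; rewrite ler_nat; case: eqP => // <-.
      by rewrite bp_final_tfinal.
    apply: le_trans (Ex_tfinal_le w01 _ (finset.subsetT A)) _.
    rewrite /F le_eqVlt; apply/orP; left; apply/eqP; apply: eq_bigl => v.
    by rewrite finset.in_setT.
  have -> : \sum_(A : {set V} | B #|A|) F A =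
     \sum_(t1 < n1.+1) \sum_(t2 < n2.+1)
        \sum_(A : {set V} | B #|A| && ((ncom1 A == t1) && (ncom2 A == t2))) F A.
    rewrite (partition_big (fun A => Ordinal (ncom1_le A : (ncom1 A < n1.+1)%N)) predT) //=.
    apply: eq_bigr => t1 _.
    rewrite (partition_big (fun A => Ordinal (ncom2_le A : (ncom2 A < n2.+1)%N)) predT) //=.
    by apply: eq_bigr => t2 _; apply: eq_bigl => A; rewrite -!val_eqE /= andbA.
  apply: ler_sum => t1 _; apply: ler_sum => t2 _.
  have [hB|hB] := boolP (B (t1 + t2)%N); last first.
    rewrite big_pred0 // => A; apply/negP => /and3P[hA /eqP e1 /eqP e2].
    by rewrite ncomD e1 e2 (negbTE hB) in hA.
  have key z1 z2 (hz1 : 0 < z1 <= 1) (hz2 : 0 < z2 <= 1) := type_sum_le r hp1 hp2 hq S t1 t2 hz1 hz2.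
  have le0 : \sum_(A : {set V} | B #|A| && ((ncom1 A == t1) && (ncom2 A == t2))) F A
      <= \sum_(A : {set V} | ((ncom1 A == t1) && (ncom2 A == t2))) F A.
    rewrite big_mkcond [leRHS]big_mkcond; apply: ler_sum => A _.
    by case: (B _) => //=; case: ifP.
  apply: (le_trans le0).
  (* A type with fewer active nodes than seeds in a community has total weight 0, whatever the
     tilts. *)
  have [/andP[b1 b2]|b12] := boolP ((a1 <= t1)%N && (a2 <= t2)%N); last first.
    have h01 : 0 < (1 : R) <= 1 by rewrite ltr01 lexx.
    have := key 1 1 h01 h01; rewrite cS1 cS2 (negbTE b12) => h.
    by apply: le_trans h _; exact: beta0.
  have [||z1 [z2 [hz1 hz2 hz]]] := hbeta t1 t2 _ _ hB.
    by rewrite b1 -ltnS /=.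
    by rewrite b2 -ltnS /=.
  by have := key z1 z2 hz1 hz2; rewrite cS1 cS2 b1 b2 => h; apply: le_trans h hz.
have s0 m a (S : {set 'I_m}) : 0 <= seed_pmf R a S.
  by rewrite /seed_pmf; case: ifP => // _; rewrite invr_ge0 ler0n.
have -> : Pr p1 p2 q a1 a2 (fun w : outcome n1 n2 => B #|final_active r w|) =
    \sum_(S1 : {set 'I_n1}) \sum_(S2 : {set 'I_n2}) seed_pmf R a1 S1 * seed_pmf R a2 S2 * L S1 S2.
  rewrite /Pr big_mkcond /=.
  transitivity (\sum_(x : ({set {set V}} * {set 'I_n1})%type) \sum_(S2 : {set 'I_n2})
     sbm_pmf p1 p2 q x.1 * seed_pmf R a1 x.2 * seed_pmf R a2 S2 *
     (B #|final_active r ((x, S2) : outcome n1 n2)|)%:R).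
    rewrite pair_bigA /=; apply: eq_bigr => -[x y] _ /=.
    by rewrite /outcome_pmf; case: (B _); rewrite /= ?mulr1 ?mulr0.
  rewrite exchange_big /= [RHS]exchange_big /=; apply: eq_bigr => S2 _.
  transitivity (\sum_(g : {set {set V}}) \sum_(S1 : {set 'I_n1}) sbm_pmf p1 p2 q g * seed_pmf R a1 S1 * seed_pmf R a2 S2 *
     (B #|final_active r ((g, S1, S2) : outcome n1 n2)|)%:R).
    by rewrite pair_bigA /=; apply: eq_bigr => -[x y].
  rewrite exchange_big /=; apply: eq_bigr => S1 _.
  rewrite /L mulr_sumr; apply: eq_bigr => g _; rewrite /final_active /seeds /=.
  by ring.
apply: (@le_trans _ _ (\sum_(S1 : {set 'I_n1}) \sum_(S2 : {set 'I_n2}) seed_pmf R a1 S1 * seed_pmf R a2 S2 * M)).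
  apply: ler_sum => S1 _; apply: ler_sum => S2 _.
  have [e1|e1] := eqVneq #|S1| a1; last by rewrite /seed_pmf (negbTE e1) !mul0r.
  have [e2|e2] := eqVneq #|S2| a2; last by rewrite /seed_pmf (negbTE e2) !mulr0 !mul0r.
  by apply: ler_wpM2l; rewrite ?mulr_ge0 ?s0 // LM.
under eq_bigr do rewrite -mulr_suml -mulr_sumr sum_seed_pmf // mulr1.
by rewrite -mulr_suml sum_seed_pmf // mul1r.
Qed.

End FinalSize.

(** * The supercritical condition *)

Section SupCondition.
Variables (R : realType) (r : nat).
Hypothesis hr : (2 <= r)%N.
Implicit Types (alpha chi x y : R).

Lemma rho_mono_snd alpha chi x y y' : 0 <= chi -> 0 <= x -> 0 <= y ->
  y <= y' -> rho r alpha chi x y <= rho r alpha chi x y'.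
Proof.
move=> chi0 x0 y0 yy'; rewrite /rho lerD2l; apply: ler_wpM2l.
  rewrite mulr_ge0 ?invr_ge0 ?ler0n // exprn_ge0 // subr_ge0 invf_le1 ?ltr0n ?ler1n;
  by apply: leq_trans hr.
apply: lerXn2r; rewrite ?nnegrE ?addr_ge0 ?mulr_ge0 //; first exact: le_trans yy'.
by rewrite lerD2l ler_wpM2l.
Qed.

Lemma exprB_ge (u v : R) n : 0 <= v -> v <= u ->
  n.+1%:R * (u - v) * v ^+ n <= u ^+ n.+1 - v ^+ n.+1.
Proof.
move=> v0 vu; rewrite subrXX -mulrA mulrCA; apply: ler_wpM2l; first by rewrite subr_ge0.
have -> : n.+1%:R * v ^+ n = \sum_(i < n.+1) v ^+ n.
  by rewrite sumr_const card_ord mulr_natl.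
apply: ler_sum => i _.
have -> : v ^+ n = v ^+ (n.+1 - i.+1)%N * v ^+ i by rewrite -exprD subSS subnK // -ltnS.
apply: ler_wpM2r; first by rewrite exprn_ge0.
by apply: lerXn2r; rewrite ?nnegrE // (le_trans v0).
Qed.

(** The derivative of [rho] in its own coordinate is ((1 - 1/r)(x + chi y))^(r-1) - 1, which is
    nonnegative exactly from x + chi y = r/(r-1) on; this is where the constant in [calD] comes
    from. The proof replaces the derivative by [exprB_ge]. *)
Lemma rho_decr alpha chi x y d : 0 <= chi -> 0 <= y -> 0 <= d <= x ->
  r%:R / (r%:R - 1) <= x - d + chi * y ->
  rho r alpha chi (x - d) y <= rho r alpha chi x y.
Proof.
move=> chi0 y0 /andP[d0 dx] hb; rewrite /rho.
case: r hr hb => // n n1 hb /=; set k := n.+1%:R.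
have k1 : 1 < k by rewrite /k ltr1n.
have kp : 0 < k by lra.
have ki : 0 <= 1 - k^-1 by rewrite subr_ge0 invf_le1 // ltW.
set u := x + chi * y; set v := x - d + chi * y.
have vu : v <= u by rewrite /u /v; lra.
have v0 : 0 <= v by apply: le_trans hb; rewrite divr_ge0 //; lra.
have := exprB_ge n v0 vu; rewrite (_ : u - v = d); last by rewrite /u /v; ring.
move=> h.
have kv : 1 <= (1 - k^-1) * v.
  have : (1 - k^-1) * (k / (k - 1)) <= (1 - k^-1) * v.
    exact: ler_wpM2l.
  rewrite (_ : (1 - k^-1) * (k / (k - 1)) = 1) //; field.
  by apply/andP; split; lra.
have : d <= k^-1 * (1 - k^-1) ^+ n * (u ^+ n.+1 - v ^+ n.+1).
  apply: (@le_trans _ _ (k^-1 * (1 - k^-1) ^+ n * (k * d * v ^+ n))); last first.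
    by apply: ler_wpM2l h; rewrite mulr_ge0 ?invr_ge0 ?exprn_ge0 // ltW.
  rewrite (_ : _ * _ = d * ((1 - k^-1) * v) ^+ n); last by rewrite exprMn; field; lra.
  by rewrite -[leLHS]mulr1 ler_wpM2l // exprn_ege1.
move: (_ * (1 - k^-1) ^+ n) (u ^+ n.+1) (v ^+ n.+1) => c U W.
lra.
Qed.

Variables (a1 a2 k l : R).
Hypotheses (a10 : 0 < a1) (a20 : 0 <= a2) (k0 : 0 <= k) (l0 : 0 <= l).

Lemma rho_fst0_gt0 alpha chi y : 0 < chi * y -> 0 <= alpha ->
   0 < rho r alpha chi 0 y.
Proof.
move=> cy al; rewrite /rho subr0 add0r ltr_wpDl // mulr_gt0 ?exprn_gt0 // mulr_gt0 //.
  by rewrite invr_gt0 ltr0n; apply: leq_trans hr.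
apply: exprn_gt0; rewrite subr_gt0 invf_lt1 ?ltr1n //.
by rewrite ltr0n; apply: leq_trans hr.
Qed.

Lemma continuous_rho alpha chi :
  continuous (fun z : R * R => rho r alpha chi z.1 z.2).
Proof.
move=> z; rewrite /rho; apply: cvgD; first by apply: cvgB; [exact: cvg_cst|exact: cvg_fst].
apply: cvgM; first exact: cvg_cst.
apply: (@continuous_comp _ _ _ (fun z : R * R => z.1 + chi * z.2) (fun x => x ^+ r));
  last exact: exprn_continuous.
apply: cvgD; first exact: cvg_fst.
by apply: cvgM; [exact: cvg_cst|exact: cvg_snd].
Qed.

Lemma continuous_rho_swap alpha chi :
  continuous (fun z : R * R => rho r alpha chi z.2 z.1).
Proof.
move=> z; apply: (@continuous_comp _ _ _ (fun z : R * R => (z.2, z.1))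
    (fun z => rho r alpha chi z.1 z.2)).
  apply: (@cvg_pair _ _ _ _ (nbhs z.2) (nbhs z.1)); [exact: cvg_snd|exact: cvg_fst].
exact: continuous_rho.
Qed.

Lemma closed_sublevel (T : topologicalType) (f : T -> R) (c : R) :
  continuous f -> closed [set z | f z <= c].
Proof.
move=> cf; rewrite (_ : mkset _ = f @^-1` [set x | x <= c]) //.
by apply: preimage_closed; [move=> z _; exact: cf|exact: closed_le].
Qed.

(* If both [rho] are nonpositive somewhere, minimise [x + y] over the set below *)
(* that point where they are. Outside [calD] some coordinate could still be    *)
(* lowered: its own [rho] increases in it there, and the other [rho] always    *)
(* does. So the minimiser lies in [calD].                                      *)
Lemma sup_quadrant :
  (forall x y, 0 <= x -> 0 <= y -> x + k * y <= r%:R / (r%:R - 1) ->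
     y + l * x <= r%:R / (r%:R - 1) ->
     0 < rho r a1 k x y \/ 0 < rho r a2 l y x) ->
  forall x y, 0 <= x -> 0 <= y -> 0 < rho r a1 k x y \/ 0 < rho r a2 l y x.
Proof.
move=> sup x0 y0 hx0 hy0; set b := r%:R / (r%:R - 1) in sup *.
have b0 : 0 < b.
  rewrite divr_gt0 ?ltr0n ?subr_gt0 ?ltr1n //; exact: leq_trans hr.
apply: contrapT => /not_orP[/negP n1 /negP n2].
rewrite -leNgt in n1; rewrite -leNgt in n2.
pose A := (`[0, x0]%classic `*` `[0, y0]%classic) `&`
  [set z : R * R | rho r a1 k z.1 z.2 <= 0] `&` [set z : R * R | rho r a2 l z.2 z.1 <= 0].
have cA : compact A.
  apply: compact_closedI; first apply: compact_closedI.
  - by apply: compact_setX; exact: segment_compact.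
  - by apply: closed_sublevel; exact: continuous_rho.
  - by apply: closed_sublevel; exact: continuous_rho_swap.
have A0 : A !=set0 by exists (x0, y0); rewrite /A /= !in_itv /= !lexx hx0 hy0.
have cf : {within A, continuous (fun z : R * R => z.1 + z.2)}.
  apply: continuous_subspaceT => z.
  by apply: cvgD; [exact: cvg_fst|exact: cvg_snd].
have [[x y] /set_mem /= [[[]]]] := compact_EVT_min A0 cA cf.
rewrite /= !in_itv /= => /andP[hx xx0] /andP[hy yy0] r1 r2 min.
have step1 d : 0 < d <= x -> b <= x - d + k * y -> False.
  move=> /andP[d0 dx] h.
  have := min (x - d, y); rewrite /= => H.
  suff : x + y <= x - d + y by lra.
  apply: H; apply: mem_set; rewrite /A /= !in_itv /=; split; first split.
  - by split; apply/andP; split => //; lra.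
  - by apply: le_trans r1; apply: rho_decr => //; rewrite (ltW d0).
  - by apply: le_trans r2; apply: rho_mono_snd => //; lra.
have step2 d : 0 < d <= y -> b <= y - d + l * x -> False.
  move=> /andP[d0 dx] h.
  have := min (x, y - d); rewrite /= => H.
  suff : x + y <= x + (y - d) by lra.
  apply: H; apply: mem_set; rewrite /A /= !in_itv /=; split; first split.
  - by split; apply/andP; split => //; lra.
  - by apply: le_trans r1; apply: rho_mono_snd => //; lra.
  - by apply: le_trans r2; apply: rho_decr => //; rewrite (ltW d0).
have [hb1|hb1] := leP (x + k * y) b.
  have [hb2|hb2] := leP (y + l * x) b.
    by have [] := sup x y hx hy hb1 hb2; rewrite ltNge ?r1 ?r2.
  (* A coordinate equal to 0 cannot be lowered, but then the violated constraint makes its own [rho]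
     positive. *)
  have [y00|y00] := eqVneq y 0.
    have := @rho_fst0_gt0 a2 l x; rewrite y00 add0r in hb2 *.
    by rewrite y00 in r2; move=> /(_ (lt_trans b0 hb2) a20); rewrite ltNge r2.
  (* The largest decrease that keeps [y] nonnegative and [y + l * x] at least [b]. *)
  apply: (step2 (Num.min y (y + l * x - b))).
    by rewrite lt_min lt_neqAle eq_sym y00 hy ge_min lexx /= subr_gt0 andbT.
  have : Num.min y (y + l * x - b) <= y + l * x - b by rewrite ge_min lexx orbT.
  lra.
have [x00|x00] := eqVneq x 0.
  have := @rho_fst0_gt0 a1 k y; rewrite x00 add0r in hb1 *.
  by rewrite x00 in r1; move=> /(_ (lt_trans b0 hb1) (ltW a10)); rewrite ltNge r1.
apply: (step1 (Num.min x (x + k * y - b))).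
  by rewrite lt_min lt_neqAle eq_sym x00 hx ge_min lexx /= subr_gt0 andbT.
have : Num.min x (x + k * y - b) <= x + k * y - b by rewrite ge_min lexx orbT.
lra.
Qed.

(** The maximum of the two [rho] is continuous and positive, so it has a positive minimum on the
    compact square. *)
Lemma sup_uniform :
  (forall x y, 0 <= x -> 0 <= y -> 0 < rho r a1 k x y \/ 0 < rho r a2 l y x) ->
  forall L, 0 <= L -> exists2 d, 0 < d &
    forall x y, 0 <= x <= L -> 0 <= y <= L ->
      d <= rho r a1 k x y \/ d <= rho r a2 l y x.
Proof.
move=> sup L L0.
pose A := (`[0, L]%classic `*` `[0, L]%classic : set (R * R)).
have cA : compact A by apply: compact_setX; exact: segment_compact.
have A0 : A !=set0 by exists (0, 0); rewrite /A /= !in_itv /= !lexx L0.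
pose f1 (z : R * R) := rho r a1 k z.1 z.2.
pose f2 (z : R * R) := rho r a2 l z.2 z.1.
have cf1 : continuous f1 by exact: continuous_rho.
have cf2 : continuous f2 by exact: continuous_rho_swap.
have cf : {within A, continuous (fun z : R * R => Num.max (f1 z) (f2 z))}.
  apply: continuous_subspaceT => z.
  by apply: (@continuous_max R _ f1 f2 z (cf1 z) (cf2 z)).
have [[x y] /set_mem /= []] := compact_EVT_min A0 cA cf.
rewrite /= !in_itv /= => /andP[hx xx0] /andP[hy yy0] min.
set m := Num.max (f1 (x, y)) _ in min.
exists m.
  by rewrite /m lt_max; have [] := sup x y hx hy; rewrite /f1 /f2 /= => ->; rewrite ?orbT.
move=> x' y' hx' hy'.
have : m <= Num.max (f1 (x', y')) (f2 (x', y')).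
  by apply: min; apply: mem_set; rewrite /A /= !in_itv.
by rewrite le_max => /orP.
Qed.

End SupCondition.

(** * Bounds at fixed size *)

Lemma expRN_le (R : realType) (th : R) : 0 <= th -> th * (1 - th) <= 1 - expR (- th).
Proof.
move=> th0; have h := expR_ge1Dx th.
have hp : 0 < 1 + th by lra.
have : expR (- th) <= (1 + th)^-1 by rewrite expRN lef_pV2 // posrE ?expR_gt0.
have : (1 + th)^-1 * (1 + th) = 1 by rewrite mulVf // gt_eqF.
move: (_^-1) (expR _) => u v; nra.
Qed.

Lemma expR_natX (R : realType) (x : R) k : expR x ^+ k = expR (k%:R * x).
Proof. by rewrite expRM_natl. Qed.

(** Chernoff's bound for a binomial variable to be as small as k: the generating function at
    exp(-th) is bounded by 1 - x <= exp(-x). *)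
Lemma tilt_le (R : realType) (N k : nat) (pi th : R) : 0 <= pi <= 1 -> 0 <= th ->
  (expR (- th) ^+ k)^-1 * (1 - pi * (1 - expR (- th))) ^+ N <=
  expR (th * k%:R - N%:R * pi * (1 - expR (- th))).
Proof.
move=> /andP[p0 p1] th0; rewrite expRD expR_natX -expRN.
rewrite (_ : - (k%:R * - th) = th * k%:R); last by ring.
apply: ler_wpM2l; first exact: expR_ge0.
set x := pi * _; rewrite (_ : - (N%:R * pi * (1 - expR (- th))) = N%:R * - x); last by rewrite /x; ring.
rewrite expRM_natl; apply: lerXn2r; rewrite ?nnegrE ?expR_ge0 //.
  have e0 := expR_ge0 (- th).
  have e1 : expR (- th) <= 1 by rewrite -expR0 ler_expR oppr_le0.
  by rewrite /x; nra.
exact: expR_ge1Dx.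
Qed.

(** With 1 - exp(-th) >= th (1 - th), the exponent is at most -2 th d g + th^2 (k + 2 d g), and the
    condition on [th] bounds the quadratic term by th d g. *)
Lemma drift_tilt_le (R : realType) (N k : nat) (pi g d L th : R) :
  0 <= pi <= 1 -> 0 < d -> 0 <= g -> k%:R <= L * g -> 0 < th ->
  th * (L + 2 * d) <= d -> k%:R + 2 * d * g <= N%:R * pi ->
  (expR (- th) ^+ k)^-1 * (1 - pi * (1 - expR (- th))) ^+ N <= expR (- (th * d * g)).
Proof.
move=> hpi d0 g0 kL th0 hth hN; apply: (le_trans (tilt_le _ _ hpi (ltW th0))).
have := expRN_le (ltW th0); rewrite ler_expR.
have k0 : 0 <= k%:R :> R by rewrite ler0n.
set E := 1 - expR _ => hE; have dg : 0 <= d * g by rewrite mulr_ge0 // ltW.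
have E0 : 0 <= E.
  have : expR (- th) <= expR 0 by rewrite ler_expR oppr_le0 ltW.
  by rewrite expR0 /E subr_ge0.
have h1 : (k%:R + 2 * d * g) * E <= N%:R * pi * E by apply: ler_wpM2r.
have h2 : (k%:R + 2 * d * g) * (th * (1 - th)) <= (k%:R + 2 * d * g) * E.
  by apply: ler_wpM2l; rewrite // -mulrA; lra.
have h3 : th * (th * k%:R) <= th * (th * (L * g)) by rewrite !ler_wpM2l ?(ltW th0).
have h4 : th * (g * (th * (L + 2 * d))) <= th * (g * d).
  by apply: ler_wpM2l; rewrite ?(ltW th0) // ler_wpM2l.
lra.
Qed.

Lemma Xn_sub_ge (R : realType) (y eta Y : R) n : 0 <= y <= Y -> 0 <= eta <= y ->
  y ^+ n.+1 - n.+1%:R * Y ^+ n * eta <= (y - eta) ^+ n.+1.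
Proof.
move=> /andP[y0 yY] /andP[e0 ey].
have : y ^+ n.+1 - (y - eta) ^+ n.+1 <= n.+1%:R * Y ^+ n * eta.
  rewrite subrXX opprB addrC subrK mulrC ler_wpM2r //.
  rewrite mulr_natl -[n.+1 in leRHS]card_ord -sumr_const; apply: ler_sum => i _.
  have -> : Y ^+ n = Y ^+ (n.+1 - i.+1)%N * Y ^+ i by rewrite -exprD subSS subnK // -ltnS.
  have Y0 : 0 <= Y by exact: le_trans yY.
  rewrite subSS; apply: ler_pM; rewrite ?exprn_ge0 ?subr_ge0 // lerXn2r ?nnegrE ?subr_ge0 //.
  by rewrite lerBlDr (le_trans yY) // lerDl.
lra.
Qed.

Lemma sum_two_nseq (R : realType) (t t' : nat) (P Q : R) :
  \sum_(p <- nseq t P ++ nseq t' Q) p = t%:R * P + t'%:R * Q.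
Proof.
rewrite big_cat /=; congr (_ + _);
by rewrite big_nseq iter_addr_0 mulr_natl.
Qed.

(** The coefficient of the power in [rho]. *)
Definition kappa (R : realType) (r : nat) : R := r%:R^-1 * (1 - r%:R^-1) ^+ r.-1.

Lemma kappa_gt0 (R : realType) (r : nat) : (2 <= r)%N -> 0 < kappa R r.
Proof.
move=> hr; have r0 : 0 < r%:R :> R by rewrite ltr0n; apply: leq_trans hr.
by rewrite mulr_gt0 ?invr_gt0 ?exprn_gt0 // subr_gt0 invf_lt1 // ltr1n.
Qed.

Section Drift.
Variables (R : realType) (r : nat).
Hypothesis hr : (2 <= r)%N.
Variables (N a t t' : nat) (P Q g g' m alpha chi L d e : R).
Hypotheses (P01 : 0 < P <= m) (Q01 : 0 <= Q <= m) (m1 : m <= 1).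
Hypotheses (g0 : 0 < g) (g'0 : 0 < g') (aN : (a <= N)%N) (at_ : (a <= t)%N).
Hypotheses (chi0 : 0 <= chi) (L0 : 0 <= L) (d0 : 0 < d) (e01 : 0 < e <= 1).
(* [g] is [gcrit r N P], by [gcrit_pow]. *)
Hypothesis hg : N%:R * P ^+ r * g ^+ r.-1 = r`!%:R * kappa R r.
Hypotheses (ha : alpha - d <= a%:R / g) (haN : a%:R / N%:R <= e).
Hypotheses (hchi : `|(g' * Q) / (g * P) - chi| <= e) (hgP : g * P <= e).
Hypotheses (hm : r%:R * m <= e * (g * P)).
Let Y := L * (1 + chi).
Let E := 1 + (Y + L).
Hypothesis he : e * (kappa R r * (r%:R * Y ^+ r.-1 * (L + 1) + E * Y ^+ r)) <= d.
Hypothesis he1 : e * (Y + L) <= 1.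
Hypotheses (ht : t%:R <= L * g) (ht' : t'%:R <= L * g').
Hypothesis hrho : 4 * d <= rho r alpha chi (t%:R / g) (t'%:R / g').

(** The expected number of active neighbours is [s = g * P * (x + ch * y')] with [ch] close to
    [chi], and [hg] turns N (g P y)^r / r! into [kappa * y ^ r * g]. Of the margin [4 * d] in
    [hrho], one [d] pays for the approximation of the mean ([key]), one for replacing [alpha] by
    [a / g], and [2 * d] is left. The number [e] bounds all the small errors at once. *)
Lemma drift_ge :
  (t - a)%:R + 2 * d * g <= (N - a)%:R * pb (nseq t P ++ nseq t' Q) r.
Proof.
have /andP[P0 Pm] := P01; have /andP[Q0 Qm] := Q01; have /andP[e0 e1] := e01.
have hrho' := hrho; have hchi' := hchi.
set x := t%:R / g in hrho'; set y' := t'%:R / g' in hrho'.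
have x0 : 0 <= x by rewrite divr_ge0 ?ler0n // ltW.
have y'0 : 0 <= y' by rewrite divr_ge0 ?ler0n // ltW.
have xL : x <= L by rewrite ler_pdivrMr.
have y'L : y' <= L by rewrite ler_pdivrMr.
set y := x + chi * y'.
have y0 : 0 <= y by rewrite addr_ge0 // mulr_ge0.
have yY : y <= Y by rewrite /y /Y mulrDr mulr1 lerD // mulrC ler_wpM2r.
have Y0 : 0 <= Y by exact: le_trans yY.
have kp := kappa_gt0 R hr.
have pP : probs (nseq t P ++ nseq t' Q).
  rewrite /probs all_cat !all_nseq Q0 (ltW P0) (le_trans Pm m1) (le_trans Qm m1).
  by rewrite !orbT.
have pbp := pb_ge0_le1 r pP; set pi := pb _ _ in pbp *.
set s := t%:R * P + t'%:R * Q.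
set ch := (g' * Q) / (g * P) in hchi'.
have gP0 : 0 < g * P by rewrite mulr_gt0.
have sE : s = g * P * (x + ch * y').
  rewrite /s /x /ch /y'; field.
  by rewrite !gt_eqF.
have /andP[ch1 ch2] : - e <= ch - chi <= e by rewrite -ler_norml.
have eta0 : 0 <= e * (L + 1) by rewrite mulr_ge0 ?(ltW e0) ?addr_ge0.
have hr1 : r.-1.+1 = r by rewrite prednK //; apply: leq_trans hr.
have key : kappa R r * y ^+ r - d <= (N - a)%:R * pi / g.
  (* For such a small [y] the bound [he] gives [kappa * y ^ r <= d], and the left-hand side is
     nonpositive. *)
  have [ys|ys] := leP y (e * (L + 1)).
    apply: (@le_trans _ _ 0); last first.
      by rewrite divr_ge0 ?(ltW g0) // mulr_ge0 ?ler0n //; case/andP: pbp.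
    rewrite subr_le0; apply: le_trans he.
    rewrite mulrCA ler_pM2l // -[in leLHS]hr1 exprS.
    apply: (@le_trans _ _ (e * (L + 1) * Y ^+ r.-1)).
      by apply: ler_pM; rewrite ?exprn_ge0 // lerXn2r ?nnegrE.
    rewrite -mulrA ler_pM2l //.
    have r1 : 1 <= r%:R :> R by rewrite ler1n; apply: leq_trans hr.
    have X0 : 0 <= Y ^+ r.-1 by rewrite exprn_ge0.
    have X1 : 0 <= E * Y ^+ r by rewrite mulr_ge0 ?exprn_ge0 // /E; lra.
    apply: (@le_trans _ _ (r%:R * Y ^+ r.-1 * (L + 1))); last by rewrite lerDl.
    by rewrite mulrC ler_wpM2r ?addr_ge0 // ler_peMl.
  have chy : (ch - chi) * y' >= - (e * L).
    have : - e * y' <= (ch - chi) * y' by exact: ler_wpM2r.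
    have : e * y' <= e * L by rewrite ler_wpM2l // ltW.
    by lra.
  have chy2 : (ch - chi) * y' <= e * L.
    have : (ch - chi) * y' <= e * y' by exact: ler_wpM2r.
    have : e * y' <= e * L by rewrite ler_wpM2l // ltW.
    by lra.
  (* [e * L] covers the replacement of [chi] by [ch], and the remaining [e] covers the loss [r * m]
     in [pb_ge], by [hm]. *)
  set z := y - e * (L + 1).
  have z0 : 0 < z by rewrite subr_gt0.
  have sz : g * P * z <= s - r%:R * m.
    have : g * P * (z + e) <= g * P * (x + ch * y').
      by apply: ler_wpM2l; [exact: ltW|rewrite /z /y; lra].
    by rewrite -sE; have := hm; lra.
  have s1 : s <= e * (Y + L).
    rewrite sE; apply: ler_pM => //; first exact: ltW.
      by rewrite -(pmulr_rge0 _ gP0) -sE addr_ge0 // mulr_ge0 ?ler0n // ltW.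
    have : e * L <= L by rewrite ler_piMl.
    by move: yY; rewrite /y; lra.
  have gz0 : 0 <= g * P * z by rewrite mulr_ge0 // ltW.
  have pige : (1 - s) * ((g * P * z) ^+ r / r`!%:R) <= pi.
    apply: (@le_trans _ _ ((1 - s) * ((s - r%:R * m) ^+ r / r`!%:R))).
      apply: ler_wpM2l; first by rewrite subr_ge0 (le_trans s1).
      apply: ler_wpM2r; first by rewrite invr_ge0 ler0n.
      by apply: lerXn2r; rewrite ?nnegrE // (le_trans gz0).
    rewrite /s -sum_two_nseq; apply: pb_ge; rewrite ?sum_two_nseq -/s.
    - by rewrite all_cat !all_nseq Q0 Qm (ltW P0) Pm !orbT.
    - by rewrite m1 andbT (le_trans Q0).
    - by rewrite (le_trans s1 he1) andbT -subr_ge0 (le_trans gz0).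
  have N0 : 0 < N%:R :> R.
    rewrite lt_neqAle ler0n andbT eq_sym; apply/eqP => N0; move: hg.
    rewrite N0 !mul0r => /esym/eqP; rewrite mulf_eq0 pnatr_eq0 -leqn0 leqNgt fact_gt0.
    by rewrite (gt_eqF kp).
  have Na : N%:R * (1 - e) <= (N - a)%:R.
    rewrite natrB // mulrBr mulr1 lerD2l lerN2 mulrC.
    by rewrite -ler_pdivrMr.
  have main : kappa R r * (1 - e) * (1 - s) * z ^+ r <= (N - a)%:R * pi / g.
    rewrite ler_pdivlMr //.
    apply: (@le_trans _ _ (N%:R * (1 - e) * ((1 - s) * ((g * P * z) ^+ r / r`!%:R)))).
      rewrite le_eqVlt; apply/orP; left; apply/eqP.
      have f0 : r`!%:R != 0 :> R by rewrite pnatr_eq0 -lt0n fact_gt0.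
      have -> : kappa R r = N%:R * P ^+ r * g ^+ r.-1 / r`!%:R by rewrite hg mulrC mulKf.
      rewrite !exprMn -[in g ^+ r]hr1 exprS; field.
      by [].
    apply: ler_pM => //.
    - by rewrite mulr_ge0 ?ler0n // subr_ge0.
    - rewrite mulr_ge0 ?divr_ge0 ?exprn_ge0 ?ler0n // subr_ge0; exact: le_trans he1.
  apply: le_trans main.
  have zr : y ^+ r - r%:R * Y ^+ r.-1 * (e * (L + 1)) <= z ^+ r.
    by rewrite -{1 2 4}hr1; apply: Xn_sub_ge; rewrite ?y0 ?eta0 //= ltW.
  have zY : z ^+ r <= Y ^+ r by apply: lerXn2r; rewrite ?nnegrE ?(ltW z0) // (le_trans _ yY) // gerBl.
  have zr0 : 0 <= z ^+ r by rewrite exprn_ge0 // ltW.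
  have s0 : 0 <= s by rewrite addr_ge0 ?mulr_ge0 ?ler0n // ltW.
  (* The factor 1 - e accounts for the seeds and 1 - s comes from [pb_ge]; [s1] bounds s. *)
  have es : 1 - e * E <= (1 - e) * (1 - s).
    have : 0 <= e * s by rewrite mulr_ge0 // ltW.
    rewrite /E; lra.
  have h1 : kappa R r * ((1 - e * E) * z ^+ r) <= kappa R r * ((1 - e) * (1 - s) * z ^+ r).
    by rewrite ler_pM2l // ler_wpM2r.
  have h2 : kappa R r * (e * E * z ^+ r) <= kappa R r * (e * E * Y ^+ r).
    by rewrite ler_pM2l // ler_wpM2l // mulr_ge0 ?(ltW e0) // /E; lra.
  have h3 : kappa R r * (y ^+ r - r%:R * Y ^+ r.-1 * (e * (L + 1))) <= kappa R r * z ^+ r.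
    by rewrite ler_pM2l.
  move: h1 h2 h3 he; lra.
have : (kappa R r * y ^+ r - d) * g <= (N - a)%:R * pi by rewrite -ler_pdivlMr.
apply: le_trans.
rewrite natrB //; have -> : t%:R = x * g by rewrite divfK // gt_eqF.
have -> : a%:R = a%:R / g * g :> R by rewrite divfK // gt_eqF.
rewrite -mulrBl -mulrDl ler_pM2r //.
move: hrho' ha; rewrite /rho -/(kappa R r) -/y; move: (kappa R r * _) => u; lra.
Qed.

End Drift.

(** With s = T p, the assumptions give s - r p >= s/2 and 1 - s >= 1/2 in [pb_ge]. *)
Lemma pb_nseq_ge (R : realType) (r T : nat) (p : R) : 0 <= p <= 1 ->
  (2 * r <= T)%N -> T%:R * p <= 1 / 2 ->
  (T%:R * p / 2) ^+ r / (2 * r`!%:R) <= pb (nseq T p) r.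
Proof.
move=> /andP[p0 p1] rT Tp.
have sE : \sum_(x <- nseq T p) x = T%:R * p by rewrite big_nseq iter_addr_0 mulr_natl.
have rT' : 2 * r%:R <= T%:R :> R by rewrite -natrM ler_nat.
have rp : r%:R * p <= T%:R * p / 2.
  by rewrite ler_pdivlMr // mulrAC ler_wpM2r // mulrC.
have Tp0 : 0 <= T%:R * p by rewrite mulr_ge0.
have h : r%:R * p <= \sum_(x <- nseq T p) x <= 1 by rewrite sE; apply/andP; split; lra.
apply: le_trans (pb_ge _ _ h); last first.
- by rewrite p0.
- by rewrite all_nseq p0 lexx orbT.
rewrite sE (_ : _ / (2 * _) = 2^-1 * ((T%:R * p / 2) ^+ r / r`!%:R)); last first.
  by field; rewrite pnatr_eq0 -lt0n fact_gt0.
apply: ler_pM; rewrite ?divr_ge0 ?exprn_ge0 ?ler0n //; first lra.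
  by lra.
apply: ler_wpM2r; first by rewrite invr_ge0 ler0n.
apply: lerXn2r; rewrite ?nnegrE; lra.
Qed.

(** The bound of [pb_nseq_ge] at T p = 1/4. *)
Definition c_half (R : realType) (r : nat) : R := (8^-1) ^+ r / (2 * r`!%:R).

Lemma c_half_gt0 (R : realType) r : 0 < c_half R r.
Proof. by rewrite divr_gt0 ?exprn_gt0 ?invr_gt0 ?mulr_gt0 ?ltr0n ?fact_gt0. Qed.

Lemma pb_nseq_ge_const (R : realType) (r T : nat) (p : R) : (0 < r)%N ->
  0 < p -> 8 * r%:R * p <= 1 -> 1 / 2 < T%:R * p ->
  c_half R r <= pb (nseq T p) r.
Proof.
move=> r0 p0 rp Tp.
have r1 : 1 <= r%:R :> R by rewrite ler1n.
have p1 : 8 * p <= 1 by apply: le_trans rp; nra.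
have h0 : 0 <= (2 * p)^-1 by rewrite invr_ge0 mulr_ge0 // ltW.
(* Only the integer part of 1/(2p) of the trials is kept. Then T' p lies between 1/2 - p and 1/2,
   where [pb_nseq_ge] applies. *)
have /andP[] := Num.Theory.truncn_itv h0; set T' := Num.truncn _ => T1 T2.
have pV : (2 * p)^-1 * p = 1 / 2 by field; rewrite gt_eqF.
have T1' : T'%:R * p <= 1 / 2 by rewrite -pV ler_pM2r.
have T2' : 1 / 2 - p < T'%:R * p.
  have : (2 * p)^-1 * p < T'.+1%:R * p by rewrite ltr_pM2r.
  by rewrite pV -natr1; lra.
have rT : (2 * r <= T')%N.
  rewrite -(ler_nat R) natrM -(ler_pM2r p0); lra.
have TT : (T' <= T)%N.
  rewrite -(ler_nat R) -(ler_pM2r p0); lra.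
have p01 : 0 <= p <= 1 by apply/andP; split; lra.
apply: le_trans (pb_nseq_le r TT p01).
apply: le_trans (pb_nseq_ge p01 rT T1').
apply: ler_wpM2r; first by rewrite invr_ge0 mulr_ge0 ?ler0n.
by apply: lerXn2r; rewrite ?nnegrE; lra.
Qed.

Lemma expR1_ge2 (R : realType) : 2 <= expR 1 :> R.
Proof. by have := @expR_ge1Dx R 1; lra. Qed.

Lemma compl_pb_nseq_le (R : realType) (r T : nat) (p eps : R) :
  0 <= p <= 1 -> 0 < eps -> 2 * (r%:R + 2 / eps) <= T%:R * p ->
  1 - pb (nseq T p) r <= expR (- (2 / eps)).
Proof.
move=> p01 eps0 hT.
apply: le_trans (compl_pb_le r _) _; first by rewrite /probs all_nseq p01 orbT.
apply: (@le_trans _ _ (expR r%:R * expR (- ((\sum_(x <- nseq T p) x) / 2)))).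
  rewrite ler_wpM2r ?expR_ge0 // -[r%:R in leRHS]mulr1 expRM_natl.
  by rewrite lerXn2r ?nnegrE ?expR_ge0 ?expR1_ge2.
by rewrite -expRD ler_expR big_nseq iter_addr_0 -mulr_natl; lra.
Qed.

(** * Tilting bounds for the three ranges of the final size *)

Section Large.
Variables (R : realType) (r : nat).
Hypothesis hr : (2 <= r)%N.
Implicit Types (n t : nat) (p P : R).

Lemma pb_two_ge t t' P P' p : 0 <= p <= 1 -> p <= P <= 1 -> p <= P' <= 1 ->
  pb (nseq (t + t') p) r <= pb (nseq t P ++ nseq t' P') r.
Proof.
move=> /andP[p0 p1] /andP[pP P1] /andP[pP' P'1].
have P0 : 0 <= P by exact: le_trans pP.
have P'0 : 0 <= P' by exact: le_trans pP'.
apply: pb_le.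
- by rewrite /probs all_nseq p0 p1 orbT.
- by rewrite /probs all_cat !all_nseq P0 P1 P'0 P'1 !orbT.
rewrite nseqD; elim: t => [|t IH] /=; last by rewrite pP.
by elim: t' => //= t' ->; rewrite pP'.
Qed.

(** With tilt exp(-1), using 1 - exp(-1) >= 1/2 and that at least half of the nodes are not seeds,
    the exponent is at most T - n pi / 4, and the factor 8 makes this at most -T. *)
Lemma middle_le (n1 n2 a1 a2 t1 t2 : nat) (pi_1 pi_2 pi : R) :
  0 <= pi_1 <= 1 -> 0 <= pi_2 <= 1 -> 0 <= pi -> pi <= pi_1 -> pi <= pi_2 ->
  (a1 <= n1)%N -> (a2 <= n2)%N ->
  (a1 + a2)%:R <= (n1 + n2)%:R / 2 :> R ->
  8 * (t1 + t2)%:R <= (n1 + n2)%:R * pi ->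
  stop_bound n1 n2 a1 a2 t1 t2 pi_1 pi_2 (expR (-1)) (expR (-1)) <= expR (- (t1 + t2)%:R).
Proof.
move=> h1 h2 p0 hp1 hp2 an1 an2 ha ht.
rewrite stop_boundE.
have E0 : 1 / 2 <= 1 - expR (-1) :> R.
  have : expR (-1) <= 2^-1 :> R.
    rewrite expRN lef_pV2 ?posrE ?expR_gt0 //.
    by have := @expR_ge1Dx R 1; lra.
  lra.
have th0 : (0 : R) <= 1 by [].
apply: le_trans (ler_pM _ _ (tilt_le (n1 - a1) (t1 - a1) h1 th0) (tilt_le (n2 - a2) (t2 - a2) h2 th0)) _.
- case/andP: h1 => *; rewrite mulr_ge0 ?invr_ge0 ?exprn_ge0 ?expR_ge0 //.
  by have := expR_ge0 (-1 : R); nra.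
- case/andP: h2 => *; rewrite mulr_ge0 ?invr_ge0 ?exprn_ge0 ?expR_ge0 //.
  by have := expR_ge0 (-1 : R); nra.
rewrite -expRD ler_expR !mul1r.
have k1 : (t1 - a1)%:R <= t1%:R :> R by rewrite ler_nat leq_subr.
have k2 : (t2 - a2)%:R <= t2%:R :> R by rewrite ler_nat leq_subr.
have m1 : (n1 - a1)%:R * pi * (1 / 2) <= (n1 - a1)%:R * pi_1 * (1 - expR (-1)).
  apply: ler_pM => //; first by rewrite mulr_ge0 ?ler0n.
  by rewrite ler_wpM2l ?ler0n.
have m2 : (n2 - a2)%:R * pi * (1 / 2) <= (n2 - a2)%:R * pi_2 * (1 - expR (-1)).
  apply: ler_pM => //; first by rewrite mulr_ge0 ?ler0n.
  by rewrite ler_wpM2l ?ler0n.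
have m3 : (n1 + n2)%:R / 2 * pi <= ((n1 - a1)%:R + (n2 - a2)%:R) * pi.
  apply: ler_wpM2r => //; rewrite !natrB //.
  by move: ha; rewrite !natrD; lra.
move: ht m1 m2 m3; rewrite !natrD; move: (_ * pi_1 * _) (_ * pi_2 * _) => u v; lra.
Qed.

(** The tilt equals the bound [eta] on the failure probability, so that 1 - pi (1 - eta) <= 2 eta
    and the whole is at most 2^n eta^(n - T). Since n - T >= eps n, the choice of [eta] gives eta^(n
    - T) <= exp(-2n), against 2^n <= exp(n). *)
Lemma late_le (n1 n2 a1 a2 t1 t2 : nat) (pi_1 pi_2 eps : R) : 0 < eps ->
  let eta := expR (- (2 / eps)) in
  0 <= pi_1 <= 1 -> 0 <= pi_2 <= 1 ->
  1 - eta <= pi_1 -> 1 - eta <= pi_2 ->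
  (a1 <= t1 <= n1)%N -> (a2 <= t2 <= n2)%N ->
  (t1 + t2)%:R <= (1 - eps) * (n1 + n2)%:R ->
  stop_bound n1 n2 a1 a2 t1 t2 pi_1 pi_2 eta eta <= expR (- (n1 + n2)%:R).
Proof.
move=> eps0 eta h1 h2 hp1 hp2 /andP[at1 tn1] /andP[at2 tn2] ht.
have eta0 : 0 < eta by exact: expR_gt0.
have eta1 : eta <= 1 by rewrite -expR0 ler_expR oppr_le0 divr_ge0 // ltW.
have one (n a t : nat) pi : (a <= t)%N -> (t <= n)%N -> 0 <= pi <= 1 -> 1 - eta <= pi ->
    (eta ^+ (t - a))^-1 * (1 - pi * (1 - eta)) ^+ (n - a) <= 2 ^+ n * eta ^+ (n - t).
  move=> ta tn /andP[p0 p1] hp.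
  have nonneg : 0 <= 1 - pi * (1 - eta) by nra.
  apply: (@le_trans _ _ ((eta ^+ (t - a))^-1 * (2 * eta) ^+ (n - a))).
    apply: ler_wpM2l; first by rewrite invr_ge0 exprn_ge0 // ltW.
    by apply: lerXn2r; rewrite ?nnegrE ?mulr_ge0 ?(ltW eta0) //; nra.
  have na : (n - a = t - a + (n - t))%N by rewrite [RHS]addnC addnBA // subnK.
  rewrite exprMn [in X in _ * (_ * X)]na (exprD eta) mulrCA mulKf; last by rewrite gt_eqF // exprn_gt0.
  apply: ler_wpM2r; first by rewrite exprn_ge0 // ltW.
  by apply: ler_weXn2l; [lra|exact: leq_subr].
rewrite stop_boundE.
have nn pi k l : 0 <= pi <= 1 -> 0 <= (eta ^+ k)^-1 * (1 - pi * (1 - eta)) ^+ l.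
  move=> /andP[p0 p1]; rewrite mulr_ge0 ?invr_ge0 ?exprn_ge0 ?(ltW eta0) //.
  by nra.
apply: le_trans (ler_pM (nn _ _ _ h1) (nn _ _ _ h2) (one _ _ _ _ at1 tn1 h1 hp1) (one _ _ _ _ at2 tn2 h2 hp2)) _.
rewrite mulrACA -!exprD.
apply: (@le_trans _ _ (expR (n1 + n2)%:R * expR (- (2 * (n1 + n2)%:R)))); last first.
  by rewrite -expRD ler_expR; lra.
apply: ler_pM; rewrite ?exprn_ge0 ?(ltW eta0) //.
  by rewrite -[in leRHS](mulr1 (n1 + n2)%:R) expRM_natl lerXn2r ?nnegrE ?expR_ge0 ?expR1_ge2.
rewrite /eta expR_natX ler_expR mulrN lerN2 !natrD !natrB //.
rewrite mulrA ler_pdivlMr // mulrC [leRHS]mulrC.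
move: ht; rewrite !natrD => ht; nra.
Qed.

End Large.

(** Only the community with a surplus is tilted; the tilt 1 makes the factor of the other one equal
    to 1. *)
Lemma early_le (R : realType) (n1 n2 a1 a2 t1 t2 : nat) (pi_1 pi_2 g1 g2 d L : R) :
  let th := Num.min 1 (d / (L + 2 * d)) in
  0 <= pi_1 <= 1 -> 0 <= pi_2 <= 1 -> 0 < d -> 0 <= L -> 0 <= g1 -> 0 <= g2 ->
  t1%:R <= L * g1 -> t2%:R <= L * g2 ->
  (t1 - a1)%:R + 2 * d * g1 <= (n1 - a1)%:R * pi_1 \/
  (t2 - a2)%:R + 2 * d * g2 <= (n2 - a2)%:R * pi_2 ->
  exists z1 z2, [/\ 0 < z1 <= 1, 0 < z2 <= 1 &
    stop_bound n1 n2 a1 a2 t1 t2 pi_1 pi_2 z1 z2 <= expR (- (th * d * Num.min g1 g2))].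
Proof.
move=> th h1 h2 d0 L0 g10 g20 tL1 tL2 hd.
have th0 : 0 < th by rewrite lt_min ltr01 divr_gt0 //; lra.
have thd : th * (L + 2 * d) <= d.
  by rewrite -ler_pdivlMr ?ge_min ?lexx ?orbT //; lra.
have z01 : 0 < expR (- th) <= 1.
  by rewrite expR_gt0 -[leRHS]expR0 ler_expR oppr_le0 ltW.
have one01 : 0 < (1 : R) <= 1 by rewrite ltr01 lexx.
have sub (t a : nat) (g : R) : t%:R <= L * g -> (t - a)%:R <= L * g.
  by apply: le_trans; rewrite ler_nat leq_subr.
have triv (N k : nat) (pi : R) : ((1 : R) ^+ k)^-1 * (1 - pi * (1 - 1)) ^+ N = 1.
  by rewrite expr1n invr1 mul1r subrr mulr0 subr0 expr1n.
have mono (g : R) : Num.min g1 g2 <= g -> expR (- (th * d * g)) <= expR (- (th * d * Num.min g1 g2)).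
  by move=> hg; rewrite ler_expR lerN2 ler_pM2l // mulr_gt0.
case: hd => hd; [exists (expR (- th)), 1|exists 1, (expR (- th))]; split => //;
  rewrite stop_boundE triv ?mulr1 ?mul1r.
  apply: le_trans (mono g1 _); last by rewrite ge_min lexx.
  by apply: (@drift_tilt_le R _ _ _ g1 d L) => //; exact: sub.
apply: le_trans (mono g2 _); last by rewrite ge_min lexx orbT.
by apply: (@drift_tilt_le R _ _ _ g2 d L) => //; exact: sub.
Qed.

(* Past [K g] the mean number [n pb] of nodes with [r] active neighbours is    *)
(* already a large multiple of [T], by superlinearity of [T |-> T^r].          *)
Lemma mean_ge (R : realType) (r n T : nat) (p g c K : R) : (2 <= r)%N ->
  0 < p -> 8 * r%:R * p <= 1 -> (2 * r <= T)%N -> 0 < g -> 0 < c ->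
  c <= n%:R * p ^+ r * g ^+ r.-1 ->
  1 <= K -> 8 * (2 ^+ r * (2 * r`!%:R)) <= c * K -> K * g <= T%:R ->
  8 * T%:R <= c_half R r * n%:R ->
  8 * T%:R <= n%:R * pb (nseq T p) r.
Proof.
move=> hr p0 rp rT g0 c0 hc K1 hK KT hT.
have r0 : (0 < r)%N by apply: ltnW.
have p01 : 0 <= p <= 1.
  have : 1 <= r%:R :> R by rewrite ler1n.
  by move=> ?; apply/andP; split; nra.
(* Beyond T p = 1/2 each node succeeds with probability at least [c_half]. Below, [pb_nseq_ge] gives
   T times n p^r T^(r-1) up to a constant, and T >= K g with r >= 2 bounds n p^r T^(r-1) below by c
   K. *)
have [Tp|Tp] := leP (T%:R * p) (1 / 2); last first.
  apply: (le_trans hT); rewrite mulrC ler_wpM2l ?ler0n //.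
  exact: pb_nseq_ge_const.
apply: le_trans (ler_wpM2l _ (pb_nseq_ge p01 rT Tp)); last exact: ler0n.
have f0 : 0 < 2 ^+ r * (2 * r`!%:R) :> R by rewrite !mulr_gt0 ?exprn_gt0 ?ltr0n ?fact_gt0.
have -> : n%:R * ((T%:R * p / 2) ^+ r / (2 * r`!%:R)) =
    T%:R * (n%:R * p ^+ r * T%:R ^+ r.-1) / (2 ^+ r * (2 * r`!%:R)).
  rewrite !exprMn -[in T%:R ^+ r](prednK r0) exprS exprVn.
  by field; rewrite expf_neq0 //= pnatr_eq0 -lt0n fact_gt0.
rewrite ler_pdivlMr // mulrAC [leLHS]mulrC ler_wpM2l ?ler0n //.
apply: (le_trans hK).
apply: (@le_trans _ _ (c * K ^+ r.-1)).
  by rewrite ler_pM2l // -[leLHS]expr1 ler_weXn2l // -subn1 subn_gt0.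
apply: (@le_trans _ _ (n%:R * p ^+ r * g ^+ r.-1 * K ^+ r.-1)).
  by rewrite ler_wpM2r // exprn_ge0 // (le_trans ler01).
rewrite -mulrA ler_wpM2l ?mulr_ge0 ?ler0n ?exprn_ge0 ?(ltW p0) //.
rewrite -exprMn lerXn2r ?nnegrE ?ler0n ?mulr_ge0 ?(ltW g0) ?(le_trans ler01 K1) //.
by rewrite mulrC.
Qed.

(** * Asymptotics *)

Lemma gcrit_pow (R : realType) (r n : nat) (p : R) : (2 <= r)%N -> (0 < n)%N ->
  0 < p -> n%:R * p ^+ r * gcrit r n p ^+ r.-1 = r`!%:R * kappa R r.
Proof.
move=> hr n0 p0.
have r0 : 0 < r.-1%:R :> R by rewrite ltr0n -subn1 subn_gt0.
have rE : r%:R - 1 = r.-1%:R :> R by rewrite -[in LHS](@prednK r) ?(ltnW hr) // -natr1 addrK.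
have np0 : 0 < n%:R * p ^+ r by rewrite mulr_gt0 ?ltr0n ?exprn_gt0.
rewrite /gcrit rE exprMn -(powR_mulrn _ (powR_ge0 _ _)) -powRrM mulVf ?gt_eqF //.
rewrite powRr1; last by rewrite divr_ge0 ?ler0n // ltW.
rewrite /kappa -[in r`!](@prednK r) ?(ltnW hr) // factS prednK ?(ltnW hr) // natrM.
have rn0 : r%:R != 0 :> R by rewrite pnatr_eq0 -lt0n ltnW.
field.
by rewrite rn0 expf_neq0 ?gt_eqF // ltr0n.
Qed.

Lemma gcrit_gt0 (R : realType) (r n : nat) (p : R) : (2 <= r)%N -> (0 < n)%N ->
  0 < p -> 0 < gcrit r n p.
Proof.
move=> hr n0 p0; rewrite /gcrit mulr_gt0 //.
  rewrite subr_gt0 invf_lt1 ?ltr1n // ltr0n; exact: ltnW.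
by rewrite powR_gt0 // divr_gt0 ?ltr0n ?fact_gt0 // mulr_gt0 ?ltr0n ?exprn_gt0.
Qed.

Lemma ler_of_pXn (R : realType) (x y : R) m : (0 < m)%N -> 0 <= x -> 0 <= y ->
  x ^+ m <= y ^+ m -> x <= y.
Proof. by move=> m0 x0 y0; rewrite ler_pXn2r. Qed.

Section Community.
Variables (R : realType) (r : nat) (N : nat -> nat) (P : nat -> R).
Hypothesis hr : (2 <= r)%N.
Hypothesis hP : forall n, 0 <= P n < 1.
Hypothesis hN : \forall n \near \oo, (0 < N n)%N.
Hypothesis lb : much_less (fun n => (N n)%:R^-1) P.
Hypothesis ub : much_less P (fun n => ((N n)%:R `^ r%:R^-1)^-1).
Let g n := gcrit r (N n) (P n).
Let C0 : R := r`!%:R * kappa R r.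

Let C0_gt0 : 0 < C0.
Proof. by rewrite mulr_gt0 ?kappa_gt0 // ltr0n fact_gt0. Qed.

Let r1_gt0 : (0 < r.-1)%N.
Proof. by rewrite -subn1 subn_gt0. Qed.

Lemma near_P_gt0 : \forall n \near \oo, 0 < P n.
Proof.
by apply: filterS lb.1 => n Pn; rewrite lt_neqAle eq_sym Pn; case/andP: (hP n).
Qed.

Lemma near_NP_ge M : \forall n \near \oo, M <= (N n)%:R * P n.
Proof.
pose M' := Num.max M 1; have M'0 : 0 < M' by rewrite lt_max ltr01 orbT.
have := lb.2 => /cvgr0Pnorm_le /(_ M'^-1); rewrite invr_gt0 => /(_ M'0) h.
near=> n.
have N0 : 0 < (N n)%:R :> R by rewrite ltr0n; near: n.
have P0 : 0 < P n by near: n; exact: near_P_gt0.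
have : `|(N n)%:R^-1 / P n| <= M'^-1 by near: n.
rewrite -invfM ger0_norm ?invr_ge0 ?mulr_ge0 ?(ltW P0) ?(ltW N0) // lef_pV2 ?posrE ?mulr_gt0 //.
by apply: le_trans; rewrite le_max lexx.
Unshelve. all: by end_near. Qed.

(** N P^r = (P N^(1/r))^r tends to 0, while its product with g^(r-1) is the constant [C0]. *)
Lemma near_g_ge M : \forall n \near \oo, M <= g n.
Proof.
pose M' := Num.max M 1; have M'0 : 0 < M' by rewrite lt_max ltr01 orbT.
pose e := Num.min 1 (C0 / M' ^+ r.-1).
have e0 : 0 < e by rewrite lt_min ltr01 divr_gt0 // exprn_gt0.
have := ub.2 => /cvgr0Pnorm_le /(_ e e0) h.
near=> n.
have N0 : (0 < N n)%N by near: n.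
have P0 : 0 < P n by near: n; exact: near_P_gt0.
have g0 : 0 < g n by exact: gcrit_gt0.
have hg := gcrit_pow hr N0 P0; rewrite -/(g n) -/C0 in hg.
have : `|P n / ((N n)%:R `^ r%:R^-1)^-1| <= e by near: n.
rewrite invrK ger0_norm ?mulr_ge0 ?powR_ge0 ?(ltW P0) // => hle.
have NP : (N n)%:R * P n ^+ r <= e.
  have -> : (N n)%:R * P n ^+ r = (P n * (N n)%:R `^ r%:R^-1) ^+ r.
    rewrite exprMn -(powR_mulrn _ (powR_ge0 _ _)) -powRrM mulVf ?powRr1 ?ler0n //.
      by rewrite mulrC.
    by rewrite pnatr_eq0 -lt0n ltnW.
  apply: (@le_trans _ _ (e ^+ r)).
    by apply: lerXn2r; rewrite ?nnegrE ?mulr_ge0 ?powR_ge0 ?(ltW P0) ?(ltW e0).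
  rewrite -[leRHS]expr1; apply: ler_wiXn2l; rewrite ?(ltW e0) ?ge_min ?lexx ?(ltnW hr) //.
apply: (@le_trans _ _ M'); first by rewrite le_max lexx.
apply: (@ler_of_pXn _ _ _ r.-1) => //; [exact: ltW|exact: ltW|].
have Mp : 0 < M' ^+ r.-1 by rewrite exprn_gt0.
have gp : 0 < g n ^+ r.-1 by rewrite exprn_gt0.
have eC : e <= C0 / M' ^+ r.-1 by rewrite ge_min lexx orbT.
have : C0 <= C0 / M' ^+ r.-1 * g n ^+ r.-1.
  by rewrite -[leLHS]hg ler_wpM2r ?(ltW gp) // (le_trans NP).
by rewrite mulrAC ler_pdivlMr // ler_pM2l.
Unshelve. all: by end_near. Qed.

(** The product of N P and (g P)^(r-1) is the constant [C0], and N P tends to infinity. *)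
Lemma near_gP_le e : 0 < e -> \forall n \near \oo, g n * P n <= e.
Proof.
move=> e0; have ep : 0 < e ^+ r.-1 by rewrite exprn_gt0.
near=> n.
have N0 : (0 < N n)%N by near: n.
have P0 : 0 < P n by near: n; exact: near_P_gt0.
have g0 : 0 < g n by exact: gcrit_gt0.
have hg := gcrit_pow hr N0 P0; rewrite -/(g n) -/C0 in hg.
have h : C0 / e ^+ r.-1 <= (N n)%:R * P n by near: n; exact: near_NP_ge.
apply: (@ler_of_pXn _ _ _ r.-1) => //; [by rewrite ltW // mulr_gt0|exact: ltW|].
have NP0 : 0 < (N n)%:R * P n by rewrite mulr_gt0 ?ltr0n.
rewrite -(ler_pM2l NP0).
have -> : (N n)%:R * P n * (g n * P n) ^+ r.-1 = C0.
  rewrite -hg exprMn -[in P n ^+ r](@prednK r) ?(ltnW hr) // exprS; ring.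
by rewrite -ler_pdivrMr.
Unshelve. all: by end_near. Qed.

Lemma near_g_le e : 0 < e -> \forall n \near \oo, g n <= e * (N n)%:R.
Proof.
move=> e0; near=> n.
have P0 : 0 < P n by near: n; exact: near_P_gt0.
rewrite -(ler_pM2r P0).
apply: (@le_trans _ _ e); first by near: n; exact: near_gP_le.
by rewrite -mulrA ler_peMr ?(ltW e0) //; near: n; exact: near_NP_ge.
Unshelve. all: by end_near. Qed.


End Community.

Lemma near_dist_le (R : realType) (u : nat -> R) (l : R) :
  u n @[n --> \oo] --> l ->
  forall e, 0 < e -> \forall n \near \oo, `|l - u n| <= e.
Proof. by move=> h e e0; move/cvgrPdist_le: h; apply. Qed.

Lemma is_bigO_near (R : realType) (f1 f2 : nat -> R) (M : R) :
  (forall n, 0 < f2 n) -> (\forall n \near \oo, `|f1 n| <= M * f2 n) ->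
  is_bigO f1 f2.
Proof.
move=> f20 h; split; first by near=> n; rewrite gt_eqF.
apply: (@le_lt_trans _ _ M%:E); last exact: ltry.
pose V := [set n | `|f1 n| <= M * f2 n].
apply: (@le_trans _ _ (ereal_sup ((fun n => (`|f1 n / f2 n|)%:E) @` V))).
  by apply: ereal_inf_lbound; exists V.
apply: ge_ereal_sup => _ [n /= Vn <-].
by rewrite lee_fin normrM normfV (gtr0_norm (f20 n)) ler_pdivrMr.
Unshelve. all: by end_near. Qed.

(** For x >= 0, |y^m - x^m| is at least |y - x| y^(m-1). *)
Lemma cvg_root (R : realType) (x : nat -> R) (y : R) (m : nat) : (0 < m)%N ->
  0 < y -> (forall n, 0 <= x n) -> x n ^+ m @[n --> \oo] --> y ^+ m ->
  x n @[n --> \oo] --> y.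
Proof.
move=> m0 y0 x0 h; apply/cvgrPdist_le => e e0.
have e'0 : 0 < e * y ^+ m.-1 by rewrite mulr_gt0 // exprn_gt0.
have := near_dist_le h e'0; apply: filterS => n.
case: m m0 {h e'0} => // m _ /=; rewrite subrXX normrM => hle.
have yp : 0 < y ^+ m by rewrite exprn_gt0.
rewrite -(ler_pM2r yp); apply: le_trans hle; apply: ler_wpM2l => //.
rewrite big_ord_recl /= subn0 expr0 mulr1.
apply: le_trans (ler_norm _); rewrite lerDl.
by apply: sumr_ge0 => i _; rewrite mulr_ge0 ?exprn_ge0 // ltW.
Qed.

(** The smallness conditions of [drift_ge] on the parameters do not involve [t] and [t'], so a
    single threshold for [n] serves all of them. The common bound on the edge probabilities is
    [C * P n]. *)
Lemma near_drift (R : realType) (r : nat) (N a : nat -> nat) (P Q g' : nat -> R)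
    (alpha chi C L d : R) :
  (2 <= r)%N -> (forall n, 0 <= P n < 1) -> (forall n, 0 <= Q n) ->
  (\forall n \near \oo, (0 < N n)%N) ->
  much_less (fun n => (N n)%:R^-1) P ->
  much_less P (fun n => ((N n)%:R `^ r%:R^-1)^-1) ->
  (forall n, (a n <= N n)%N) ->
  (a n)%:R / gcrit r (N n) (P n) @[n --> \oo] --> alpha ->
  (g' n * Q n) / (gcrit r (N n) (P n) * P n) @[n --> \oo] --> chi ->
  (\forall n \near \oo, 0 < g' n) ->
  1 <= C -> (\forall n \near \oo, Q n <= C * P n) ->
  0 <= chi -> 0 <= L -> 0 < d ->
  \forall n \near \oo, forall t t' : nat, (a n <= t)%N ->
    t%:R <= L * gcrit r (N n) (P n) -> t'%:R <= L * g' n ->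
    4 * d <= rho r alpha chi (t%:R / gcrit r (N n) (P n)) (t'%:R / g' n) ->
    (t - a n)%:R + 2 * d * gcrit r (N n) (P n) <=
      (N n - a n)%:R * pb (nseq t (P n) ++ nseq t' (Q n)) r.
Proof.
move=> hr hP hQ hN lb ub haN ha hchi hg' C1 hQP chi0 L0 d0.
pose g n := gcrit r (N n) (P n).
pose Y := L * (1 + chi); pose E := 1 + (Y + L).
pose K0 := kappa R r * (r%:R * Y ^+ r.-1 * (L + 1) + E * Y ^+ r).
have Y0 : 0 <= Y by rewrite mulr_ge0 // addr_ge0.
have E0 : 0 < E by rewrite /E; lra.
have K00 : 0 <= K0.
  rewrite mulr_ge0 ?(ltW (kappa_gt0 R hr)) //.
  by rewrite addr_ge0 ?mulr_ge0 ?ler0n ?exprn_ge0 ?(ltW E0) // addr_ge0.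
pose e := Num.min 1 (Num.min (d / (1 + K0)) E^-1).
have e0 : 0 < e by rewrite !lt_min ltr01 invr_gt0 E0 divr_gt0 //; lra.
have e1 : e <= 1 by rewrite ge_min lexx.
have eK : e * K0 <= d.
  have : e * (1 + K0) <= d.
    rewrite -ler_pdivlMr; last by lra.
    by rewrite !ge_min lexx !orbT.
  lra.
have eE : e * (Y + L) <= 1.
  have : e * E <= 1 by rewrite -ler_pdivlMr // div1r !ge_min lexx !orbT.
  rewrite /E; lra.
pose A := 1 + `|alpha|.
have A0 : 0 < A by rewrite /A; have := normr_ge0 alpha; lra.
near=> n.
have N0 : (0 < N n)%N by near: n.
have P0 : 0 < P n by near: n; exact: near_P_gt0 lb.
have g0 : 0 < g n by exact: gcrit_gt0.
(* This is the condition [hm] of [drift_ge] divided by [P n]. *)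
have gC : r%:R * C / e <= g n by near: n; exact: near_g_ge.
have gC1 : C <= g n by near: n; exact: near_g_ge.
have gP1 : g n * P n <= 1 by near: n; apply: near_gP_le.
have CP1 : C * P n <= 1 by apply: le_trans gP1; rewrite ler_pM2r.
move=> t t' at_ ht ht' hrho.
apply: (@drift_ge R r hr (N n) (a n) t t' (P n) (Q n) (g n) (g' n) (C * P n) alpha chi L d e) => //.
- by rewrite P0 ler_peMl // ltW.
- by rewrite hQ; near: n.
- by near: n.
- by rewrite e0.
- exact: gcrit_pow.
- have : `|alpha - (a n)%:R / g n| <= d by near: n; exact: near_dist_le.
  by rewrite ler_norml => /andP[_]; lra.
- rewrite ler_pdivrMr ?ltr0n //.
  have : `|alpha - (a n)%:R / g n| <= 1 by near: n; exact: near_dist_le.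
  rewrite ler_norml => /andP[h _].
  have hA : (a n)%:R / g n <= A by rewrite /A; have := ler_norm alpha; lra.
  have h1 : (a n)%:R <= A * g n by rewrite -ler_pdivrMr.
  have : g n <= e / A * (N n)%:R by near: n; apply: near_g_le => //; rewrite divr_gt0.
  rewrite -(ler_pM2l A0); move=> h2; apply: (le_trans h1); apply: (le_trans h2).
  by rewrite mulrA mulrCA divff ?gt_eqF // mulr1.
- by rewrite distrC; near: n; exact: near_dist_le.
- by near: n; apply: near_gP_le.
- rewrite ler_pdivrMr // in gC.
  by rewrite mulrA mulrA ler_pM2r // mulrC mulrC [leRHS]mulrC.
Unshelve. all: by end_near. Qed.

Lemma sum_expR_le (R : realType) (c : R) n : 0 < c ->
  \sum_(t < n) expR (- (c * t%:R)) <= (1 - expR (- c))^-1.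
Proof.
move=> c0; have e1 : expR (- c) < 1 by rewrite -[ltRHS]expR0 ltr_expR oppr_lt0.
rewrite -[leRHS]mul1r ler_pdivlMr ?subr_gt0 //.
have -> : \sum_(t < n) expR (- (c * t%:R)) = \sum_(t < n) expR (- c) ^+ t.
  by apply: eq_bigr => t _; rewrite expR_natX; congr expR; ring.
rewrite mulrC -opprB mulNr -subrX1 opprB lerBlDl lerDr.
by rewrite exprn_ge0 // expR_ge0.
Qed.

Lemma sum_sum_expR_le (R : realType) (c g : R) m n : 0 < c ->
  \sum_(t < m) \sum_(t' < n) expR (- (c * (g + (t%:R + t'%:R)))) <=
    (1 - expR (- c))^-1 ^+ 2 * expR (- (c * g)).
Proof.
move=> c0.
have -> : \sum_(t < m) \sum_(t' < n) expR (- (c * (g + (t%:R + t'%:R)))) =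
   (\sum_(t < m) expR (- (c * t%:R))) * (\sum_(t' < n) expR (- (c * t'%:R))) * expR (- (c * g)).
  rewrite mulr_suml mulr_suml; apply: eq_bigr => t _.
  rewrite mulr_sumr mulr_suml; apply: eq_bigr => t' _.
  by rewrite -!expRD; congr expR; ring.
apply: ler_wpM2r; first exact: expR_ge0.
rewrite expr2; apply: ler_pM; rewrite ?sum_expR_le //;
by apply: sumr_ge0 => i _; exact: expR_ge0.
Qed.

Section Ratios.
Variables (R : realType) (r : nat) (n1 n2 : nat -> nat) (p1 p2 q : nat -> R).
Variables (nu gamma mu : R).
Hypothesis hr : (2 <= r)%N.
Hypotheses (hnu : 0 < nu) (hgamma : 0 < gamma) (hmu : 0 < mu).
Hypotheses (p1_gt0 : \forall n \near \oo, 0 < p1 n) (p2_gt0 : \forall n \near \oo, 0 < p2 n).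
Hypotheses (n1_gt0 : \forall n \near \oo, (0 < n1 n)%N) (n2_gt0 : \forall n \near \oo, (0 < n2 n)%N).
Hypothesis hn12 : asymp_equiv (fun n => (n1 n)%:R) (fun n => nu * (n2 n)%:R).
Hypothesis hqp1 : asymp_equiv q (fun n => gamma * p1 n).
Hypothesis hp12 : asymp_equiv p1 (fun n => mu * p2 n).

Lemma asymp_equiv_ratio (f1 f2 : nat -> R) (c : R) : 0 < c ->
  asymp_equiv f1 (fun n => c * f2 n) -> f1 n / f2 n @[n --> \oo] --> c.
Proof.
move=> c0 [_ h]; rewrite -[X in _ --> X]mulr1.
have -> : (fun n => f1 n / f2 n) = (fun n => c * (f1 n / (c * f2 n))).
  by apply/funext => n; rewrite invfM mulrCA mulVKf // gt_eqF.
by apply: cvgM => //; exact: cvg_cst.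
Qed.

Let g1 n := gcrit r (n1 n) (p1 n).
Let g2 n := gcrit r (n2 n) (p2 n).
Let lam := (nu * mu ^+ r) `^ (r%:R - 1)^-1.

Let r1_gt0 : (0 < r.-1)%N.
Proof. by rewrite -subn1 subn_gt0. Qed.

Let rE : r%:R - 1 = r.-1%:R :> R.
Proof. by rewrite -[in LHS](@prednK r) ?(ltnW hr) // -natr1 addrK. Qed.

Let numu_gt0 : 0 < nu * mu ^+ r.
Proof. by rewrite mulr_gt0 // exprn_gt0. Qed.

Lemma lam_gt0 : 0 < lam. Proof. exact: powR_gt0. Qed.

(** By [gcrit_pow] the power r - 1 of the ratio is n1 p1^r / (n2 p2^r), which tends to nu mu^r. *)
Lemma gcrit_ratio : g2 n / g1 n @[n --> \oo] --> lam.
Proof.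
apply: (@cvg_root R _ lam r.-1) => //; first exact: lam_gt0.
  move=> n; rewrite divr_ge0 // /g1 /g2 /gcrit mulr_ge0 ?powR_ge0 // subr_ge0;
  by rewrite invf_le1 ?ler1n ?ltr0n ltnW.
have -> : lam ^+ r.-1 = nu * mu ^+ r.
  rewrite -powR_mulrn ?powR_ge0 // -powRrM rE mulVf ?powRr1 ?(ltW numu_gt0) //.
  by rewrite pnatr_eq0 -lt0n.
have h : ((n1 n)%:R / (n2 n)%:R) * (p1 n / p2 n) ^+ r @[n --> \oo] --> nu * mu ^+ r.
  apply: cvgM; first exact: asymp_equiv_ratio.
  apply: (@cvg_comp _ _ _ (fun n => p1 n / p2 n) (fun x => x ^+ r) _ (nbhs mu)).
    exact: asymp_equiv_ratio.
  exact: exprn_continuous.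
apply: cvg_trans h; apply: near_eq_cvg; near=> n.
have P1 : 0 < p1 n by near: n.
have P2 : 0 < p2 n by near: n.
have N1 : (0 < n1 n)%N by near: n.
have N2 : (0 < n2 n)%N by near: n.
have G1 : 0 < g1 n ^+ r.-1 by rewrite exprn_gt0 // gcrit_gt0.
have h1 := gcrit_pow hr N1 P1; have h2 := gcrit_pow hr N2 P2.
rewrite -/(g1 n) in h1; rewrite -/(g2 n) in h2.
rewrite !expr_div_n; apply/(mulIf (lt0r_neq0 G1)).
rewrite divfK ?gt_eqF //.
have NP2 : (n2 n)%:R * p2 n ^+ r != 0 by rewrite mulf_neq0 ?pnatr_eq0 -?lt0n // expf_neq0 // gt_eqF.
apply/(mulfI NP2); rewrite h2 -h1; field.
by rewrite expf_neq0 ?gt_eqF // ltr0n.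
Unshelve. all: by end_near. Qed.

Lemma chi12_cvg : (g2 n * q n) / (g1 n * p1 n) @[n --> \oo] --> chi12 r nu mu gamma.
Proof.
rewrite /chi12 -/lam mulrC.
have -> : (fun n => (g2 n * q n) / (g1 n * p1 n)) =
   (fun n => (g2 n / g1 n) * (q n / p1 n)).
  by apply/funext => n; rewrite invfM mulrACA.
by apply: cvgM; [exact: gcrit_ratio|exact: asymp_equiv_ratio].
Qed.

(** The limit is gamma mu / lam, and lam = (nu mu)^(1/(r-1)) mu. *)
Lemma chi21_cvg : (g1 n * q n) / (g2 n * p2 n) @[n --> \oo] --> chi21 r nu mu gamma.
Proof.
have -> : chi21 r nu mu gamma = lam^-1 * (gamma * mu).
  rewrite /chi21 powRN.
  have numu0 : 0 <= nu * mu by rewrite mulr_ge0 // ltW.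
  have -> : lam = (nu * mu) `^ (r%:R - 1)^-1 * mu.
    rewrite /lam -[in mu ^+ r](@prednK r) ?(ltnW hr) // exprS mulrA powRM ?exprn_ge0 ?(ltW hmu) //.
    rewrite -(powR_mulrn _ (ltW hmu)) -powRrM rE mulfV ?powRr1 ?(ltW hmu) //.
    by rewrite pnatr_eq0 -lt0n.
  have : 0 < (nu * mu) `^ (r%:R - 1)^-1 by rewrite powR_gt0 // mulr_gt0.
  move: (_ `^ _) => z z0; field; by rewrite !gt_eqF.
have h : (g2 n / g1 n)^-1 * ((q n / p1 n) * (p1 n / p2 n)) @[n --> \oo] --> lam^-1 * (gamma * mu).
  apply: cvgM; first by apply: cvgV; [rewrite gt_eqF // lam_gt0|exact: gcrit_ratio].
  by apply: cvgM; exact: asymp_equiv_ratio.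
apply: cvg_trans h; apply: near_eq_cvg; near=> n.
have P1 : 0 < p1 n by near: n.
have P2 : 0 < p2 n by near: n.
have N1 : (0 < n1 n)%N by near: n.
have N2 : (0 < n2 n)%N by near: n.
have G1 : 0 < g1 n by exact: gcrit_gt0.
have G2 : 0 < g2 n by exact: gcrit_gt0.
by field; rewrite !gt_eqF.
Unshelve. all: by end_near. Qed.

End Ratios.

Lemma Pr_ge0 (R : realType) (n1 n2 : nat) (p1 p2 q : R) (a1 a2 : nat)
    (B : pred (outcome n1 n2)) :
  0 <= p1 <= 1 -> 0 <= p2 <= 1 -> 0 <= q <= 1 -> 0 <= Pr p1 p2 q a1 a2 B.
Proof.
move=> h1 h2 h3; apply: sumr_ge0 => w _.
have s0 m a (S : {set 'I_m}) : 0 <= seed_pmf R a S.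
  by rewrite /seed_pmf; case: ifP => // _; rewrite invr_ge0 ler0n.
rewrite /outcome_pmf !mulr_ge0 // /sbm_pmf; case: ifP => // _.
apply: prodr_ge0 => e _.
have /andP[? ?] := edge_prob_ge0_le1 h1 h2 h3 e.
by case: ifP; rewrite ?subr_ge0.
Qed.

Lemma near_seeds_le (R : realType) (r : nat) (N a : nat -> nat) (P : nat -> R)
    (alpha : R) :
  (2 <= r)%N -> (forall n, 0 <= P n < 1) -> (\forall n \near \oo, (0 < N n)%N) ->
  much_less (fun n => (N n)%:R^-1) P ->
  (a n)%:R / gcrit r (N n) (P n) @[n --> \oo] --> alpha ->
  \forall n \near \oo, (a n)%:R <= (N n)%:R / 2 :> R.
Proof.
move=> hr hP hN lb ha; pose A := 1 + `|alpha|.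
have A0 : 0 < A by rewrite /A; have := normr_ge0 alpha; lra.
near=> n.
have P0 : 0 < P n by near: n; exact: near_P_gt0 lb.
have N0 : (0 < N n)%N by near: n.
have g0 : 0 < gcrit r (N n) (P n) by exact: gcrit_gt0.
have : `|alpha - (a n)%:R / gcrit r (N n) (P n)| <= 1 by near: n; exact: near_dist_le.
rewrite ler_norml => /andP[h _].
have : (a n)%:R / gcrit r (N n) (P n) <= A by rewrite /A; have := ler_norm alpha; lra.
rewrite ler_pdivrMr // => h1; apply: (le_trans h1).
have : gcrit r (N n) (P n) <= (2 * A)^-1 * (N n)%:R.
  by near: n; apply: near_g_le => //; rewrite invr_gt0 mulr_gt0.
rewrite -(ler_pM2l A0) => h2; apply: (le_trans h2).
by rewrite le_eqVlt; apply/orP; left; apply/eqP; field; rewrite gt_eqF.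
Unshelve. all: by end_near. Qed.

(** * Assembly over the three ranges of the final size *)

Theorem theorem3p3 (R : realType) (r : nat) (hr : (2 <= r)%N)
  (n1 n2 a1 a2 : nat -> nat) (p1 p2 q : nat -> R)
  (nu gamma mu alpha1 alpha2 : R)
  (hn : forall n, n = (n1 n + n2 n)%N)
  (ha1 : forall n, (a1 n <= n1 n)%N)
  (ha2 : forall n, (a2 n <= n2 n)%N)
  (hp1 : forall n, 0 <= p1 n < 1)
  (hp2 : forall n, 0 <= p2 n < 1)
  (hq : forall n, 0 <= q n < 1)
  (hnu : 0 < nu)
  (hgamma : 0 < gamma)
  (hmu : 0 < mu)
  (hn12 : asymp_equiv (fun n => (n1 n)%:R) (fun n => nu * (n2 n)%:R))
  (hqp1 : asymp_equiv q (fun n => gamma * p1 n))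
  (hp12 : asymp_equiv p1 (fun n => mu * p2 n))
  (hp1_lb : much_less (fun n => (n1 n)%:R^-1) p1)
  (hp1_ub : much_less p1 (fun n => ((n1 n)%:R `^ r%:R^-1)^-1))
  (hp2_lb : much_less (fun n => (n2 n)%:R^-1) p2)
  (hp2_ub : much_less p2 (fun n => ((n2 n)%:R `^ r%:R^-1)^-1))
  (hag1 : (a1 n)%:R / gcrit r (n1 n) (p1 n) @[n --> \oo] --> alpha1)
  (hag2 : (a2 n)%:R / gcrit r (n2 n) (p2 n) @[n --> \oo] --> alpha2)
  (halpha1 : 0 < alpha1)
  (halpha2 : 0 <= alpha2)
  (halpha12 : alpha2 <= alpha1)
  (hSup : calE1 r nu mu gamma alpha1 `&` calE2 r nu mu gamma alpha2 = set0) :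
  forall eps : R, 0 < eps ->
  exists c : R, 0 < c /\
    is_bigO
      (fun n => Pr (p1 n) (p2 n) (q n) (a1 n) (a2 n)
         (fun w : outcome (n1 n) (n2 n) =>
            `| #|final_active r w|%:R / n%:R - 1 | > eps))
      (fun n => expR (- (c * gcrit r (n1 n) (p1 n)))).
Proof.
move=> eps eps0.
have n2_gt0 : \forall n \near \oo, (0 < n2 n)%N.
  apply: filterS hn12.1 => n; rewrite mulf_eq0 negb_or pnatr_eq0 => /andP[_].
  by rewrite lt0n.
have n1_gt0 : \forall n \near \oo, (0 < n1 n)%N.
  have h2 : (0 : R) < 1 / 2 by lra.
  apply: filterS (near_dist_le hn12.2 h2) => n; rewrite lt0n.
  by case: eqVneq => // ->; rewrite mul0r subr0 normr1; lra.
have p1_gt0 : \forall n \near \oo, 0 < p1 n by exact: near_P_gt0 hp1_lb.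
have p2_gt0 : \forall n \near \oo, 0 < p2 n by exact: near_P_gt0 hp2_lb.
pose g1 n := gcrit r (n1 n) (p1 n); pose g2 n := gcrit r (n2 n) (p2 n).
pose lam := (nu * mu ^+ r) `^ (r%:R - 1)^-1.
have lam0 : 0 < lam by exact: lam_gt0.
have g21 : g2 n / g1 n @[n --> \oo] --> lam by exact: gcrit_ratio.
pose k := chi12 r nu mu gamma; pose l := chi21 r nu mu gamma.
have k0 : 0 <= k by rewrite mulr_ge0 ?powR_ge0 // ltW.
have l0 : 0 <= l by rewrite mulr_ge0 ?powR_ge0 // ltW.
have f0 : 0 < r`!%:R :> R by rewrite ltr0n fact_gt0.
(* Eventually [p1], [p2] and [q] are all at least [b * p1], so past [K * g1] both communities are
   compared with one edge probability. [c] and [K] are the constants that [mean_ge] asks for with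
   this probability. *)
pose b := Num.min 1 (Num.min (gamma / 2) (2 * mu)^-1).
have b0 : 0 < b by rewrite !lt_min ltr01 divr_gt0 //= invr_gt0 mulr_gt0.
pose c := b ^+ r * (r`!%:R * kappa R r).
have c0 : 0 < c.
  by apply: mulr_gt0; [exact: exprn_gt0|apply: mulr_gt0 => //; exact: kappa_gt0].
pose K := Num.max 1 (8 * (2 ^+ r * (2 * r`!%:R)) / c).
have K1 : 1 <= K by rewrite /K le_max lexx.
have hK : 8 * (2 ^+ r * (2 * r`!%:R)) <= c * K.
  by rewrite (mulrC c) -ler_pdivrMr // /K le_max lexx orbT.
(* Since [g2] is eventually at least [lam / 2 * g1], a total of at most [K * g1] gives
   [t1 <= L * g1] and [t2 <= L * g2]. *)
pose L := Num.max K (2 * K / lam).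
have L0 : 0 <= L by rewrite /L le_max (le_trans ler01 K1).
have sup x y : 0 <= x -> 0 <= y -> 0 < rho r alpha1 k x y \/ 0 < rho r alpha2 l y x.
  apply: sup_quadrant => // {}x {}y x0 y0 hx hy; apply: contrapT => /not_orP[/negP h1 /negP h2].
  rewrite -!leNgt in h1 h2; have r1 : 0 <= r%:R / (r%:R - 1) :> R.
    by rewrite divr_ge0 ?ler0n // subr_ge0 ler1n ltnW.
  have D : calD r nu mu gamma (x, y).
    split => //=; apply/andP; split => //.
      by apply: le_trans hx; rewrite lerDl mulr_ge0.
    by apply: le_trans hy; rewrite lerDl mulr_ge0.
  have : (calE1 r nu mu gamma alpha1 `&` calE2 r nu mu gamma alpha2) (x, y) by [].
  by rewrite hSup.
have [d4 d40 supd] := sup_uniform sup L0.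
pose d := d4 / 4; have d0 : 0 < d by rewrite divr_gt0.
have d4E : 4 * d = d4 by rewrite /d; field.
pose th := Num.min 1 (d / (L + 2 * d)).
have th0 : 0 < th by rewrite lt_min ltr01 divr_gt0 //; lra.
pose m := Num.min 1 (lam / 2).
have m0 : 0 < m by rewrite lt_min ltr01 divr_gt0.
(* Chosen so that [c1 * (g1 + T) <= th * d * min(g1, g2)] whenever [T <= K * g1]. The cap 1/2 in
   [cc] serves the other ranges, where [g1 + T] is at most [2 * T], respectively [2 * n]. *)
pose c1 := th * d * m / (1 + K).
have c10 : 0 < c1 by rewrite divr_gt0 ?mulr_gt0 //; lra.
pose cc := Num.min c1 (1 / 2).
have cc0 : 0 < cc by rewrite lt_min c10; lra.
exists cc; split => //.
have ccle X Y : 0 <= X -> X <= Y + Y -> cc * X <= Y.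
  move=> X0 XY; have : cc * X <= 1 / 2 * X by rewrite ler_wpM2r // /cc ge_min lexx orbT.
  by move: XY; clear; lra.
have q0 n : 0 <= q n by case/andP: (hq n).
have qp1 : q n / p1 n @[n --> \oo] --> gamma by exact: asymp_equiv_ratio.
have p12 : p1 n / p2 n @[n --> \oo] --> mu by exact: asymp_equiv_ratio.
have near_q : \forall n \near \oo, gamma / 2 * p1 n <= q n <= 2 * gamma * p1 n.
  near=> n.
  have P1 : 0 < p1 n by near: n.
  have : `|gamma - q n / p1 n| <= gamma / 2 by near: n; apply: near_dist_le; rewrite ?divr_gt0.
  rewrite ler_norml => /andP[h1 h2].
  by apply/andP; split; [rewrite -ler_pdivlMr //|rewrite -ler_pdivrMr //];
    have := hgamma; move: h1 h2; clear; lra.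
have near_p : \forall n \near \oo, p1 n <= 2 * mu * p2 n.
  near=> n.
  have P2 : 0 < p2 n by near: n.
  have : `|mu - p1 n / p2 n| <= mu / 2 by near: n; apply: near_dist_le; rewrite ?divr_gt0.
  by rewrite ler_norml => /andP[h1 h2]; rewrite -ler_pdivrMr //;
    have := hmu; move: h1; clear; lra.
have near_g : \forall n \near \oo, lam / 2 * g1 n <= g2 n.
  near=> n.
  have P1 : 0 < p1 n by near: n.
  have G1 : 0 < g1 n by apply: gcrit_gt0 => //; near: n.
  have : `|lam - g2 n / g1 n| <= lam / 2 by near: n; apply: near_dist_le; rewrite ?divr_gt0.
  by rewrite ler_norml => /andP[h1 h2]; rewrite -ler_pdivlMr //;
    move: h2; clear; lra.
have near_g1 : \forall n \near \oo, 0 < g1 n.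
  near=> n; apply: gcrit_gt0 => //; near: n; [exact: n1_gt0|exact: p1_gt0].
have near_g2 : \forall n \near \oo, 0 < g2 n.
  near=> n; apply: gcrit_gt0 => //; near: n; [exact: n2_gt0|exact: p2_gt0].
have near_qp1 : \forall n \near \oo, q n <= (1 + 2 * gamma) * p1 n.
  near=> n; have /andP[_ h] : gamma / 2 * p1 n <= q n <= 2 * gamma * p1 n by near: n.
  by apply: (le_trans h); case/andP: (hp1 n) => *; lra.
have near_qp2 : \forall n \near \oo, q n <= (1 + 2 * gamma * (2 * mu)) * p2 n.
  near=> n; have /andP[_ h] : gamma / 2 * p1 n <= q n <= 2 * gamma * p1 n by near: n.
  have h2 : p1 n <= 2 * mu * p2 n by near: n.
  apply: (le_trans h); have : 2 * gamma * p1 n <= 2 * gamma * (2 * mu * p2 n).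
    by rewrite ler_wpM2l // mulr_ge0 // ltW.
  by case/andP: (hp2 n) => *; lra.
have C1 : 1 <= 1 + 2 * gamma by lra.
have C2 : 1 <= 1 + 2 * gamma * (2 * mu).
  by rewrite lerDl !mulr_ge0 // ltW.
have drift1 := near_drift hr hp1 q0 n1_gt0 hp1_lb hp1_ub ha1 hag1
  (chi12_cvg hr hnu hgamma hmu p1_gt0 p2_gt0 n1_gt0 n2_gt0 hn12 hqp1 hp12)
  near_g2 C1 near_qp1 k0 L0 d0.
have drift2 := near_drift hr hp2 q0 n2_gt0 hp2_lb hp2_ub ha2 hag2
  (chi21_cvg hr hnu hgamma hmu p1_gt0 p2_gt0 n1_gt0 n2_gt0 hn12 hqp1 hp12)
  near_g1 C2 near_qp2 l0 L0 d0.
have hA1 := near_seeds_le hr hp1 n1_gt0 hp1_lb hag1.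
have hA2 := near_seeds_le hr hp2 n2_gt0 hp2_lb hag2.
have r0 : 0 < r%:R :> R by rewrite ltr0n ltnW.
have r8 : 0 < (8 * r%:R)^-1 :> R by rewrite invr_gt0 mulr_gt0.
apply: (@is_bigO_near R _ _ ((1 - expR (- cc))^-1 ^+ 2)); first by move=> n; exact: expR_gt0.
near=> n.
have P1 : 0 < p1 n by near: n.
have P2 : 0 < p2 n by near: n.
have N1 : (0 < n1 n)%N by near: n.
have G1 : 0 < g1 n by near: n.
have G2 : 0 < g2 n by near: n.
have hp1n : 0 <= p1 n <= 1 by case/andP: (hp1 n) => -> /ltW.
have hp2n : 0 <= p2 n <= 1 by case/andP: (hp2 n) => -> /ltW.
have hqn : 0 <= q n <= 1 by case/andP: (hq n) => -> /ltW.
rewrite ger0_norm; last exact: Pr_ge0.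
(* Keeping [t1 + t2] in the exponent beside [g1] makes the sum over all types geometric. *)
apply: le_trans (sum_sum_expR_le (g1 n) (n1 n).+1 (n2 n).+1 cc0).
apply: (@Pr_final_le R (n1 n) (n2 n) (p1 n) (p2 n) (q n) r hp1n hp2n hqn (a1 n) (a2 n)
  (fun t => `|t%:R / n%:R - 1| > eps)
  (fun t1 t2 => expR (- (cc * (g1 n + (t1%:R + t2%:R)))))) => //.
move=> t1 t2 ht1 ht2 hB.
have /andP[at1 tn1] := ht1; have /andP[at2 tn2] := ht2.
have nE : n%:R = (n1 n + n2 n)%:R :> R by rewrite -hn.
have n0 : 0 < n%:R :> R by rewrite nE ltr0n addn_gt0 N1.
have Tn : (t1 + t2)%:R <= n%:R :> R by rewrite nE ler_nat leq_add.
(* As T/n <= 1, a deviation can only be downwards. *)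
have hT : (t1 + t2)%:R <= (1 - eps) * (n1 n + n2 n)%:R.
  rewrite -nE -ler_pdivrMr //.
  have h1 : (t1 + t2)%:R / n%:R <= 1 :> R by rewrite ler_pdivrMr // mul1r.
  by move: hB; rewrite ler0_norm ?subr_le0 //; clear; lra.
rewrite -natrD; set T := (t1 + t2)%N in Tn hT *.
have pi1_01 : 0 <= pi1 (p1 n) (q n) r t1 t2 <= 1.
  apply: pb_ge0_le1; case/andP: hp1n => *; case/andP: hqn => *.
  by rewrite /probs all_cat !all_nseq; apply/andP; split; apply/orP; right; apply/andP.
have pi2_01 : 0 <= pi2 (p2 n) (q n) r t1 t2 <= 1.
  apply: pb_ge0_le1; case/andP: hp2n => *; case/andP: hqn => *.
  by rewrite /probs all_cat !all_nseq; apply/andP; split; apply/orP; right; apply/andP.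
have fin z1 z2 X : 0 < z1 <= 1 -> 0 < z2 <= 1 ->
    stop_bound (n1 n) (n2 n) (a1 n) (a2 n) t1 t2 (pi1 (p1 n) (q n) r t1 t2)
      (pi2 (p2 n) (q n) r t1 t2) z1 z2 <= expR (- X) ->
    cc * (g1 n + T%:R) <= X ->
    exists z1 z2 : R, [/\ 0 < z1 <= 1, 0 < z2 <= 1 &
      stop_bound (n1 n) (n2 n) (a1 n) (a2 n) t1 t2 (pi1 (p1 n) (q n) r t1 t2)
      (pi2 (p2 n) (q n) r t1 t2) z1 z2 <= expR (- (cc * (g1 n + T%:R)))].
  move=> hz1 hz2 h hX; exists z1, z2; split => //.
  by apply: (le_trans h); rewrite ler_expR lerN2.
have T0 : 0 <= T%:R :> R by rewrite ler0n.
have [TK|TK] := leP T%:R (K * g1 n).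
  have g12 : lam / 2 * g1 n <= g2 n by near: n.
  have tT1 : t1%:R <= K * g1 n by apply: le_trans TK; rewrite ler_nat leq_addr.
  have tT2 : t2%:R <= K * g1 n by apply: le_trans TK; rewrite ler_nat leq_addl.
  have tL1 : t1%:R <= L * g1 n.
    by apply: (le_trans tT1); rewrite ler_pM2r // /L le_max lexx.
  have tL2 : t2%:R <= L * g2 n.
    apply: (le_trans tT2); apply: (@le_trans _ _ (2 * K / lam * g2 n)); last first.
      by rewrite ler_pM2r // /L le_max lexx orbT.
    apply: (@le_trans _ _ (2 * K / lam * (lam / 2 * g1 n))).
      by rewrite le_eqVlt; apply/orP; left; apply/eqP; field; rewrite gt_eqF.
    by rewrite ler_wpM2l // divr_ge0 ?mulr_ge0 ?(ltW lam0) // (le_trans ler01).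
  have xL (t : nat) (g : R) : 0 < g -> t%:R <= L * g -> 0 <= t%:R / g <= L.
    by move=> g0 tL; rewrite divr_ge0 ?ler0n ?(ltW g0) //= ler_pdivrMr.
  have [] := @early_le R (n1 n) (n2 n) (a1 n) (a2 n) t1 t2 _ _ (g1 n) (g2 n) d L
    pi1_01 pi2_01 d0 L0 (ltW G1) (ltW G2) tL1 tL2.
    have [h|h] := supd _ _ (xL _ _ G1 tL1) (xL _ _ G2 tL2); [left|right].
      have D1 : forall t t' : nat, (a1 n <= t)%N -> t%:R <= L * g1 n -> t'%:R <= L * g2 n ->
          4 * d <= rho r alpha1 k (t%:R / g1 n) (t'%:R / g2 n) ->
          (t - a1 n)%:R + 2 * d * g1 n <=
            (n1 n - a1 n)%:R * pb (nseq t (p1 n) ++ nseq t' (q n)) r by near: n.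
      by apply: D1 => //; rewrite d4E.
    have D2 : forall t t' : nat, (a2 n <= t)%N -> t%:R <= L * g2 n -> t'%:R <= L * g1 n ->
        4 * d <= rho r alpha2 l (t%:R / g2 n) (t'%:R / g1 n) ->
        (t - a2 n)%:R + 2 * d * g2 n <=
          (n2 n - a2 n)%:R * pb (nseq t (p2 n) ++ nseq t' (q n)) r by near: n.
    rewrite /pi2 (pb_perm _ (permEl (perm_catC _ _))).
    by apply: D2 => //; rewrite d4E.
  move=> z1 [z2 [hz1 hz2 hz]]; apply: fin hz1 hz2 hz _.
  apply: (@le_trans _ _ (th * d * (m * g1 n))); last first.
    rewrite ler_pM2l ?mulr_gt0 // le_min; apply/andP; split.
      by rewrite ler_piMl ?(ltW G1) // /m ge_min lexx.
    by apply: le_trans g12; rewrite ler_pM2r // /m ge_min lexx orbT.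
  apply: (@le_trans _ _ (c1 * ((1 + K) * g1 n))).
    apply: ler_pM; rewrite ?(ltW cc0) ?addr_ge0 ?(ltW G1) //.
      by rewrite /cc ge_min lexx.
    by rewrite mulrDl mul1r lerD2l.
  rewrite le_eqVlt; apply/orP; left; apply/eqP; rewrite /c1; field.
  by rewrite gt_eqF // ltr_wpDl // (lt_le_trans ltr01).
have g1T : g1 n <= T%:R by apply: le_trans (ltW TK); rewrite ler_peMl // ltW.
pose pm := b * p1 n.
have pm0 : 0 < pm by rewrite mulr_gt0.
have b1 : b <= 1 by rewrite /b ge_min lexx.
have pm1 : pm <= p1 n by rewrite /pm ler_piMl // ltW.
have pmq : pm <= q n.
  have /andP[h _] : gamma / 2 * p1 n <= q n <= 2 * gamma * p1 n by near: n.
  by apply: le_trans h; rewrite ler_pM2r // /b !ge_min lexx !orbT.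
have pm2 : pm <= p2 n.
  have h : p1 n <= 2 * mu * p2 n by near: n.
  apply: (@le_trans _ _ ((2 * mu)^-1 * p1 n)).
    by rewrite ler_pM2r // /b !ge_min lexx !orbT.
  by rewrite mulrC ler_pdivrMr ?mulr_gt0 // mulrC.
have pm01 : 0 <= pm <= 1 by rewrite ltW //=; case/andP: hp1n => _; exact: le_trans.
have pbT01 : 0 <= pb (nseq T pm) r <= 1.
  by apply: pb_ge0_le1; rewrite /probs all_nseq pm01 orbT.
have hpi1 : pb (nseq T pm) r <= pi1 (p1 n) (q n) r t1 t2.
  apply: pb_two_ge => //; [by case/andP: hp1n => *; rewrite pm1|by case/andP: hqn => *; rewrite pmq].
have hpi2 : pb (nseq T pm) r <= pi2 (p2 n) (q n) r t1 t2.
  apply: pb_two_ge => //; [by case/andP: hqn => *; rewrite pmq|by case/andP: hp2n => *; rewrite pm2].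
have [Tmid|Tlate] := leP (8 * T%:R) (c_half R r * n%:R).
  have rT : (2 * r <= T)%N.
    rewrite -(ler_nat R); apply: le_trans g1T; near: n; exact: near_g_ge.
  have gp : g1 n * p1 n <= (8 * r%:R)^-1.
    by near: n; exact: near_gP_le.
  have g11 : 1 <= g1 n by near: n; exact: near_g_ge.
  have rp : 8 * r%:R * pm <= 1.
    rewrite mulrC -ler_pdivlMr ?mulr_gt0 // div1r; apply: le_trans gp.
    by apply: (le_trans pm1); rewrite ler_peMl // ltW.
  have hc : c <= n%:R * pm ^+ r * g1 n ^+ r.-1.
    rewrite /c -(gcrit_pow hr N1 P1) -/(g1 n) [pm ^+ r]exprMn nE.
    apply: (@le_trans _ _ ((n1 n)%:R * (b ^+ r * p1 n ^+ r * g1 n ^+ r.-1))).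
      by rewrite le_eqVlt; apply/orP; left; apply/eqP; ring.
    rewrite -[leRHS]mulrA; apply: ler_wpM2r; last by rewrite ler_nat leq_addr.
    by rewrite !mulr_ge0 ?exprn_ge0 // ltW.
  have hm := mean_ge hr pm0 rp rT G1 c0 hc K1 hK (ltW TK) Tmid.
  apply: (@fin (expR (-1)) (expR (-1)) T%:R).
  - by rewrite expR_gt0 -[leRHS]expR0 ler_expR oppr_le0 ler01.
  - by rewrite expR_gt0 -[leRHS]expR0 ler_expR oppr_le0 ler01.
  - apply: (@middle_le R (n1 n) (n2 n) (a1 n) (a2 n) t1 t2 _ _ (pb (nseq T pm) r)) => //.
    + by case/andP: pbT01.
    + have s1 : (a1 n)%:R <= (n1 n)%:R / 2 :> R by near: n.
      have s2 : (a2 n)%:R <= (n2 n)%:R / 2 :> R by near: n.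
      by rewrite !natrD mulrDl lerD.
    + by rewrite -nE.
  - by apply: ccle; rewrite ?addr_ge0 ?(ltW G1) // lerD2r.
have gn : g1 n <= n%:R.
  rewrite nE; apply: (@le_trans _ _ (1 * (n1 n)%:R)); last by rewrite mul1r ler_nat leq_addr.
  by near: n; apply: near_g_le.
pose eta := expR (- (2 / eps)) : R.
have hlate pi : pb (nseq T pm) r <= pi -> 1 - eta <= pi.
  apply: le_trans; rewrite lerBlDr -lerBlDl.
  apply: (compl_pb_nseq_le pm01 eps0).
  have c8 : 0 < c_half R r * b by rewrite mulr_gt0 // c_half_gt0.
  (* In this range [8 * T] exceeds [c_half * n], so [8 * T * pm] is at least [c_half * b * n1 * p1],
     which tends to infinity; the constant is the one required by [compl_pb_nseq_le]. *)
  have hNP : 16 * (r%:R + 2 / eps) / (c_half R r * b) <= (n1 n)%:R * p1 n.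
    by near: n; exact: near_NP_ge.
  rewrite ler_pdivrMr // in hNP.
  have h1 : (n1 n)%:R * p1 n * (c_half R r * b) <= c_half R r * n%:R * pm.
    rewrite (_ : _ * _ * (_ * _) = c_half R r * (n1 n)%:R * pm); last by rewrite /pm; ring.
    by rewrite ler_pM2r // ler_pM2l ?c_half_gt0 // nE ler_nat leq_addr.
  have h2 : c_half R r * n%:R * pm <= 8 * T%:R * pm by rewrite ler_pM2r // ltW.
  by move: hNP h1 h2; clear; lra.
have eta01 : 0 < eta <= 1.
  by rewrite expR_gt0 -[leRHS]expR0 ler_expR oppr_le0 divr_ge0 // ltW.
apply: (@fin eta eta (n1 n + n2 n)%:R) => //.
  by apply: late_le => //; exact: hlate.
by apply: ccle; rewrite ?addr_ge0 ?(ltW G1) // -nE lerD.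
Unshelve. all: by end_near. Qed.
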